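(* Let $1<p<\infty$, $\frac1p+\frac1{p'}=1$. (1) Let $v$ be a strictly positive weight on $\mathbb T^n$. Then $v^{-\frac1p}\in L^{p'}(\mathbb T^n)$ if and only if there exists a weight $u$ on $\mathbb T^n$ such that $\mathcal M^T$ maps $L^p_v(\mathbb T^n)$ into $L^p_u(\mathbb T^n)$ with the norm inequality $\|\mathcal M^Tf\|_{L^p_u(\mathbb T^n)}\le C\|f\|_{L^p_v(\mathbb T^n)}$ for all $f\in L^p_v(\mathbb T^n)$, with $C$ independent of $f$. Moreover, $v^{-1}\in L^\infty(\mathbb T^n)$ if and only if there exists a weight $u$ on $\mathbb T^n$ such that $\mathcal M^T$ maps $L^1_v(\mathbb T^n)$ into weak $L^1_u(\mathbb T^n)$. (2) Let $v$ be a strictly positive weight on $\mathbb T^n\times\mathbb R^m$. Then $v^{-\frac1p}\in L^{p'}_{loc}(\mathbb T^n\times\mathbb R^m)$ if and only if there exists a weight $u$ on $\mathbb T^n\times\mathbb R^m$ such that $\mathcal M^{WG}$ maps $L^p_v(\mathbb T^n\times\mathbb R^m)$ into $L^p_u(\mathbb T^n\times\mathbb R^m)$ with the norm inequality $\|\mathcal M^{WG}f\|_{L^p_u(\mathbb T^n\times\mathbb R^m)}\le C\|f\|_{L^p_v(\mathbb T^n\times\mathbb R^m)}$ for all $f\in L^p_v(\mathbb T^n\times\mathbb R^m)$, with $C$ independent of $f$. Moreover, $v^{-1}\in L^\infty_{loc}(\mathbb T^n\times\mathbb R^m)$ if and only if there exists a weight $u$ on $\mathbb T^n\times\mathbb R^m$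 such that $\mathcal M^{WG}$ maps $L^1_v(\mathbb T^n\times\mathbb R^m)$ into weak $L^1_u(\mathbb T^n\times\mathbb R^m)$.
   Context: $\mathbb T^n=\mathbb R^n/\mathbb Z^n$ is identified with $Q_n=[-\frac12,\frac12)^n$ and $\mathbb T^n\times\mathbb R^m$ with $Q_n\times\mathbb R^m$, with Lebesgue measure. A weight is a measurable function with values in $(0,\infty)$. For $X=\mathbb T^n$ or $X=\mathbb T^n\times\mathbb R^m$, a weight $w$ on $X$ and $1\le q<\infty$, $L^q_w(X)$ is the space of measurable $f$ with $\|f\|_{L^q_w(X)}=\|fw^{1/q}\|_{L^q(X)}<\infty$. An operator $S$ maps $L^1_v(X)$ into weak $L^1_u(X)$ if there is $C>0$ such that $\int_{\{z\in X:|Sf(z)|>\lambda\}}u\,dz\le\frac C\lambda\|f\|_{L^1_v(X)}$ for all $\lambda>0$ and $f\in L^1_v(X)$. $L^q_{loc}(X)$ denotes functions whose restriction to each compact subset $K\subset X$ is in $L^q(K)$. For a measurable function $g$ on $\mathbb R^d$, the local Hardy–Littlewood maximal function of radius $\frac12$ is $$\mathcal M_{\frac12}g(z)=\sup_{0<r\le\frac12}\frac1{|B(z,r)|}\int_{B(z,r)}|g(w)|\,dw\in[0,\infty],$$ with $B(z,r)$ the Euclidean ball. For $f$ on $\mathbb T^n$ let $f^*$ be its extension to $\mathbb R^n$ that is $1$-periodic in each coordinate, and put $\mathcal M^Tf(x)=\mathcal M_{\frac12}f^*(x)$ for $x\in Q_n$ (here $d=n$). For $f$ on $\mathbb T^n\times\mathbb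 R^m$ let $f^*$ be its extension to $\mathbb R^{n+m}$ that is $1$-periodic in each of the first $n$ coordinates, and put $\mathcal M^{WG}f(x,y)=\mathcal M_{\frac12}f^*(x,y)$ for $(x,y)\in Q_n\times\mathbb R^m$ (here $d=n+m$). In $\mathcal M^T$, the superscript $T$ stands for ''torus''. *)

(* Defs.v *)
From HB Require Import structures.
From mathcomp Require Import all_boot all_order all_algebra generic_quotient.
From mathcomp Require Import lra.
From mathcomp Require Import all_classical all_reals all_analysis.
From mathcomp Require Import measurable_realfun.
Set Implicit Arguments.
Unset Strict Implicit.
Unset Printing Implicit Defensive.
Import Order.TTheory GRing.Theory Num.Theory.
Import numFieldNormedType.Exports.
Local Open Scope classical_set_scope.
Local Open Scope ring_scope.

(* The Borel sigma-algebra of R^n, presented (as for n.-tuple in the library)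
   as the one generated by the coordinate functions. *)
Definition rV_display : measure_display.
Proof. exact: default_measure_display. Qed.

Section rV_measurable.
Context {R : realType} {n : nat}.

Let coors : 'I_n -> 'rV[R]_n -> R := fun i z => z ord0 i.

Let rV_set0 : g_sigma_preimage coors set0.
Proof. exact: sigma_algebra0. Qed.

Let rV_setC A : g_sigma_preimage coors A -> g_sigma_preimage coors (~` A).
Proof. exact: sigma_algebraC. Qed.

Let rV_bigcup (F : (set 'rV[R]_n)^nat) :
  (forall i, g_sigma_preimage coors (F i)) ->
  g_sigma_preimage coors (\bigcup_i (F i)).
Proof. exact: sigma_algebra_bigcup. Qed.

HB.instance Definition _ := @isMeasurable.Build rV_display
  'rV[R]_n (g_sigma_preimage coors) rV_set0 rV_setC rV_bigcup.

Lemma measurable_coord (i : 'I_n) :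
  measurable_fun [set: 'rV[R]_n] (fun z => z ord0 i).
Proof.
move=> _ Y mY; rewrite setTI; apply: sub_sigma_algebra => /=.
rewrite -bigcup_seq/=; exists i => /=; first by rewrite mem_index_enum.
by exists Y => //; rewrite setTI.
Qed.

Lemma measurable_fun_coord d (T : measurableType d) (f : T -> 'rV[R]_n) :
  (forall i, measurable_fun [set: T] (fun x => f x ord0 i)) ->
  measurable_fun [set: T] f.
Proof.
move=> mf; apply: (@measurability _ _ _ _ _ _
  (\big[setU/set0]_(i < n) preimage_set_system setT (coors i) measurable)) => //.
move=> _ [C + <-]; rewrite -bigcup_seq => -[i _ [A mA <-]].
rewrite setTI; have := mf i measurableT A mA.
by rewrite !setTI.
Qed.

End rV_measurable.

Section lebesgue_rV.
Context {R : realType}.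

Definition rV_cons n (p : R * 'rV[R]_n) : 'rV[R]_n.+1 :=
  row_mx p.1%:M p.2 : 'rV[R]_(1 + n).

Definition rV_uncons n (z : 'rV[R]_n.+1) : R * 'rV[R]_n :=
  (z ord0 ord0, \row_i z ord0 (lift ord0 i)).

Lemma rV_cons0 n p : @rV_cons n p ord0 ord0 = p.1.
Proof.
transitivity (row_mx p.1%:M p.2 ord0 (lshift n (ord0 : 'I_1))).
  by congr (fun_of_matrix _ _ _); exact: val_inj.
by rewrite row_mxEl mxE eqxx mulr1n.
Qed.

Lemma rV_consS n p i : @rV_cons n p ord0 (lift ord0 i) = p.2 ord0 i.
Proof.
transitivity (row_mx (p.1%:M : 'rV_1) p.2 ord0 (rshift 1 i)).
  by congr (fun_of_matrix _ _ _); exact: val_inj.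
by rewrite row_mxEr.
Qed.

Lemma rV_consK n : cancel (@rV_cons n) (@rV_uncons n).
Proof.
move=> [x y]; rewrite /rV_uncons rV_cons0; congr pair.
by apply/rowP => i; rewrite mxE rV_consS.
Qed.

Lemma measurable_rV_cons n : measurable_fun setT (@rV_cons n).
Proof.
apply: measurable_fun_coord => i; case: (unliftP ord0 i) => [j|] ->.
  rewrite [X in measurable_fun _ X](_ : _ =
      (fun z : 'rV[R]_n => z ord0 j) \o snd).
    exact: (measurableT_comp (measurable_coord j)).
  by apply/funext => p; rewrite rV_consS.
rewrite [X in measurable_fun _ X](_ : _ = fst); first exact: measurable_fst.
by apply/funext => p; rewrite rV_cons0.
Qed.

Lemma measurable_rV_uncons n : measurable_fun setT (@rV_uncons n).
Proof.
apply/measurable_fun_pairP; split; first exact: measurable_coord.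
apply: measurable_fun_coord => i /=.
rewrite [X in measurable_fun _ X](_ : _ =
    fun z : 'rV[R]_n.+1 => z ord0 (lift ord0 i)).
  exact: measurable_coord.
by apply/funext => z /=; rewrite mxE.
Qed.

Section step.
Context {n : nat} (mu : {sigma_finite_measure set 'rV[R]_n -> \bar R}).

Definition lebesgue_rV_step : set 'rV[R]_n.+1 -> \bar R :=
  pushforward (@lebesgue_measure R \x mu)%E (@rV_cons n).

Let step_measure : {measure set 'rV[R]_n.+1 -> \bar R} :=
  measure_function_pushforward__canonical__measure_function_Measure
    (@lebesgue_measure R \x mu)%E (@measurable_rV_cons n).

Let step0 : lebesgue_rV_step set0 = 0%E.
Proof. exact: (measure0 step_measure). Qed.

Let step_ge0 A : (0 <= lebesgue_rV_step A)%E.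
Proof. exact: (measure_ge0 step_measure). Qed.

Let step_sigma_additive : semi_sigma_additive lebesgue_rV_step.
Proof. exact: (@measure_semi_sigma_additive _ _ _ step_measure). Qed.

HB.instance Definition _ := isMeasure.Build _ _ _
  lebesgue_rV_step step0 step_ge0 step_sigma_additive.

Let step_sigma_finite : sigma_finite setT lebesgue_rV_step.
Proof.
have /sigma_finiteP[F [FT ndF Foo]] := sigma_finiteT (@lebesgue_measure R).
have /sigma_finiteP[G [GT ndG Goo]] := sigma_finiteT mu.
exists (fun k => @rV_uncons n @^-1` (F k `*` G k)).
  apply/esym; rewrite -subTset => z _.
  have [i _ Fi] : (\bigcup_k F k) (rV_uncons z).1 by rewrite -FT.
  have [j _ Gj] : (\bigcup_k G k) (rV_uncons z).2 by rewrite -GT.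
  exists (maxn i j) => //; split.
  - by move: Fi; exact/subsetPset/ndF/leq_maxl.
  - by move: Gj; exact/subsetPset/ndG/leq_maxr.
move=> k; have [mF Fk] := Foo k; have [mG Gk] := Goo k; split.
  rewrite -[X in measurable X]setTI; apply: measurable_rV_uncons => //.
  exact: measurableX.
rewrite /lebesgue_rV_step /pushforward -comp_preimage.
rewrite (_ : @rV_uncons n \o @rV_cons n = id); last first.
  by apply/funext => p /=; rewrite rV_consK.
by rewrite preimage_id product_measure1E// lte_mul_pinfty// ge0_fin_numE.
Qed.

HB.instance Definition _ := @Measure_isSigmaFinite.Build _ _ _
  lebesgue_rV_step step_sigma_finite.

End step.

(* Lebesgue measure on R^n (as a measure on Borel sets): the n-fold product of
   the one-dimensional Lebesgue measure; see lebesgue_rV_box. *)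
Fixpoint lebesgue_rV (n : nat) : {sigma_finite_measure set 'rV[R]_n -> \bar R} :=
  match n with
  | 0 => @dirac _ 'rV[R]_0 0 R
  | k.+1 => lebesgue_rV_step (lebesgue_rV k)
  end.

Lemma lebesgue_rV_box n (A : 'I_n -> set R) : (forall i, measurable (A i)) ->
  lebesgue_rV n [set z | forall i, A i (z ord0 i)] =
  (\prod_(i < n) lebesgue_measure (A i))%E.
Proof.
elim: n A => [|n IHn] A mA.
  rewrite big_ord0 /= diracE mem_set//= => -[].
  by case.
have mS : measurable [set z : 'rV[R]_n | forall i, A (lift ord0 i) (z ord0 i)].
  rewrite (_ : mkset _ = \bigcap_(i in [set: 'I_n])
    ((fun z : 'rV[R]_n => z ord0 i) @^-1` A (lift ord0 i))); last first.
    by apply/seteqP; split => z /= zA i *; exact: zA.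
  apply: fin_bigcap_measurable => //= i _.
  by rewrite -[X in measurable X]setTI; exact: measurable_coord.
rewrite big_ord_recl -IHn//= /lebesgue_rV_step /pushforward.
rewrite -product_measure1E//=; last exact: mA.
congr (_ _); apply/seteqP; split=> [[x y] /= h|[x y] /= [h0 hS] i].
  split; first by have := h ord0; rewrite rV_cons0.
  by move=> i; have := h (lift ord0 i); rewrite rV_consS.
case: (unliftP ord0 i) => [j|] ->; last by rewrite rV_cons0.
by rewrite rV_consS; exact: hS.
Qed.

End lebesgue_rV.

Section local_maximal.
Context {R : realType} {d : nat}.

(* The norm that the library puts on row vectors is the sup norm, hence an
   explicit Euclidean ball. *)
Definition eball (z : 'rV[R]_d) (r : R) : set 'rV[R]_d :=
  [set w | Num.sqrt (\sum_(i < d) (w ord0 i - z ord0 i) ^+ 2) < r].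

Definition local_maximal (rho : R) (g : 'rV[R]_d -> R) (z : 'rV[R]_d) : \bar R :=
  ereal_sup [set ((lebesgue_rV d (eball z r))^-1 *
      \int[lebesgue_rV d]_(w in eball z r) `|g w|%:E)%E
    | r in [set r | 0 < r <= rho]].

End local_maximal.

(* R^d / (Z^n x {0}): the first n of the d coordinates are taken modulo 1. A
   point is represented in [-1/2, 1/2)^n x R^(d-n), so that the torus T^n is the
   case d = n and T^n x R^m the case d = n + m. *)
Section cylinder.
Variables (R : realType) (n d : nat).

Definition fundamental_domain : set 'rV[R]_d :=
  [set z | forall i : 'I_d, (i < n)%N -> - 2^-1 <= z ord0 i < 2^-1].

Definition reduce (z : 'rV[R]_d) : 'rV[R]_d :=
  \row_i (if (i < n)%N then z ord0 i - (Num.floor (z ord0 i + 2^-1))%:~R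
          else z ord0 i).

Lemma reduce_fundamental z : fundamental_domain (reduce z).
Proof.
move=> i ilt; rewrite mxE ilt.
have /andP[] := floor_itv (z ord0 i + 2^-1).
by rewrite intrD1 => h1 h2; apply/andP; split; lra.
Qed.

Lemma reduce_id z : fundamental_domain z -> reduce z = z.
Proof.
move=> zQ; apply/rowP => i; rewrite mxE; case: ifPn => // ilt.
have /andP[h1 h2] := zQ i ilt.
suff -> : Num.floor (z ord0 i + 2^-1) = 0 by rewrite subr0.
by apply/floor_def; rewrite add0r; apply/andP; split; lra.
Qed.

Lemma measurable_fundamental_domain : measurable fundamental_domain.
Proof.
rewrite (_ : fundamental_domain = \bigcap_(i in [set i : 'I_d | (i < n)%N])
  ((fun z : 'rV[R]_d => z ord0 i) @^-1` `[- 2^-1, 2^-1[)); last first.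
  apply/seteqP; split => [z zQ i /= ilt|z zQ i ilt].
    by rewrite in_itv/=; exact: zQ.
  by have := zQ i ilt; rewrite /= in_itv.
apply: fin_bigcap_measurable => //= i _.
by rewrite -[X in measurable X]setTI; exact: measurable_coord.
Qed.

Record cyl_point := CylPoint {
  cyl_val : 'rV[R]_d ;
  cyl_valP : fundamental_domain cyl_val }.

Definition cyl_pi (z : 'rV[R]_d) : cyl_point := CylPoint (reduce_fundamental z).

Lemma cyl_valK : cancel cyl_val cyl_pi.
Proof.
move=> [z zQ]; rewrite /cyl_pi /=; move: (reduce_fundamental z).
by rewrite (reduce_id zQ) => zQ'; congr CylPoint; exact: Prop_irrelevance.
Qed.

HB.instance Definition _ := isQuotient.Build _ cyl_point cyl_valK.

Definition cyl : Type := quotient_topology cyl_point.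
HB.instance Definition _ := Quotient.on cyl.
HB.instance Definition _ := PointedTopological.on cyl.

Lemma repr_cyl (x : cyl) : repr x = cyl_val x.
Proof. by rewrite unlock. Qed.

Lemma repr_pi_cyl (z : 'rV[R]_d) : repr (\pi_cyl z)%qT = reduce z.
Proof. by rewrite repr_cyl unlock. Qed.

Let cyl_measurable : set (set cyl) :=
  [set A | measurable ((\pi_cyl)%qT @^-1` A : set 'rV[R]_d)].

Let cyl_measurable0 : cyl_measurable set0.
Proof. by rewrite /cyl_measurable/= preimage_set0. Qed.

Let cyl_measurableC A : cyl_measurable A -> cyl_measurable (~` A).
Proof. by rewrite /cyl_measurable/= preimage_setC; exact: measurableC. Qed.

Let cyl_measurable_bigcup (F : (set cyl)^nat) :
  (forall i, cyl_measurable (F i)) -> cyl_measurable (\bigcup_i F i).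
Proof.
move=> mF; rewrite /cyl_measurable/= preimage_bigcup.
exact: bigcupT_measurable.
Qed.

HB.instance Definition _ := @isMeasurable.Build rV_display
  cyl cyl_measurable cyl_measurable0 cyl_measurableC cyl_measurable_bigcup.

Lemma measurable_pi_cyl : measurable_fun setT (\pi_cyl : 'rV[R]_d -> cyl)%qT.
Proof. by move=> _ A mA; rewrite setTI. Qed.

(* Lebesgue measure of the part of the fundamental domain representing A. *)
Definition cyl_measure : set cyl -> \bar R :=
  pushforward (mrestr (lebesgue_rV d) measurable_fundamental_domain)
    (\pi_cyl : 'rV[R]_d -> cyl)%qT.

Let cyl_measure_measure : {measure set cyl -> \bar R} :=
  measure_function_pushforward__canonical__measure_function_Measure
    (mrestr (lebesgue_rV d) measurable_fundamental_domain) measurable_pi_cyl.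

Let cyl_measure0 : cyl_measure set0 = 0%E.
Proof. exact: (measure0 cyl_measure_measure). Qed.

Let cyl_measure_ge0 A : (0 <= cyl_measure A)%E.
Proof. exact: (measure_ge0 cyl_measure_measure). Qed.

Let cyl_measure_sigma_additive : semi_sigma_additive cyl_measure.
Proof. exact: (@measure_semi_sigma_additive _ _ _ cyl_measure_measure). Qed.

HB.instance Definition _ := isMeasure.Build _ _ _
  cyl_measure cyl_measure0 cyl_measure_ge0 cyl_measure_sigma_additive.

(* f \o \pi is the extension f^* of f to R^d, 1-periodic in the first n
   coordinates. *)
Definition cyl_maximal (f : cyl -> R) (x : cyl) : \bar R :=
  local_maximal 2^-1 (f \o \pi_cyl)%qT (repr x).

End cylinder.

Section weighted_spaces.
Context {R : realType} {n d : nat}.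
Local Notation X := (cyl R n d).
Local Notation mu := (@cyl_measure R n d).
Implicit Types (f : X -> \bar R) (w u v : X -> R).

(* Lebesgue measurability, i.e. with respect to the completion of the Borel
   sigma-algebra. The library's integral of a nonnegative function is the
   supremum of the integrals of the Borel simple functions below it, which is
   the Lebesgue integral also when the function is only Lebesgue measurable. *)
Definition lebesgue_measurable_fun f :=
  forall B : set \bar R, measurable B -> completed_algebra_gen mu (f @^-1` B).

Definition weight w :=
  lebesgue_measurable_fun (EFin \o w) /\ forall x, 0 < w x.

Definition inLp (q : \bar R) f :=
  lebesgue_measurable_fun f /\ ('N[mu]_q[f] < +oo)%E.

(* f \_ K is extended by 0 outside K, so that its norm over X is the norm of
   f over K. *)
Definition inLp_loc (q : \bar R) f :=
  forall K : set X, compact K -> inLp q (f \_ K).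

Definition wnorm (q : R) w f : \bar R :=
  'N[mu]_q%:E[(fun x => f x * (w x `^ q^-1)%:E)]%E.

Definition in_wLp (q : R) w f :=
  lebesgue_measurable_fun f /\ (wnorm q w f < +oo)%E.

Definition strong_type (q : R) (S : (X -> R) -> X -> \bar R) v u :=
  (forall f : X -> R, in_wLp q v (EFin \o f) -> in_wLp q u (S f)) /\
  exists C : R, forall f : X -> R, in_wLp q v (EFin \o f) ->
    (wnorm q u (S f) <= C%:E * wnorm q v (EFin \o f))%E.

Definition weak_type11 (S : (X -> R) -> X -> \bar R) v u :=
  exists2 C : R, 0 < C & forall (lambda : R) (f : X -> R), 0 < lambda ->
    in_wLp 1 v (EFin \o f) ->
    (\int[mu]_(z in [set z | lambda%:E < `|S f z|]) (u z)%:E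
      <= (C / lambda)%:E * wnorm 1 v (EFin \o f))%E.

End weighted_spaces.

Notation torus R n := (cyl R n n).
Notation torus_maximal R n := (@cyl_maximal R n n).
Notation waveguide R n m := (cyl R n (n + m)).
Notation waveguide_maximal R n m := (@cyl_maximal R n (n + m)).

(* Main.v *)
(* The maximal operator of radius 1/2 is of weak type (1,1) by the Vitali
   covering argument, on R^d and hence, by periodicity, on the cylinder. Being
   local, it sees near a bounded part of the cylinder only the values of f on a
   slightly larger bounded part.
   If sigma = v^(-1/(p-1)) is locally integrable, M sigma is finite a.e. and
   u = max(1, M sigma)^(-p) works: writing |f| = g sigma, the part of f where
   g <= t/2 contributes at most (t/2) M sigma to M f, so T f = M f/max(1, M sigma)
   satisfies t |{T f > t}| <= C int_{g > t/2} |f|, and the Marcinkiewicz argument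
   gives int (T f)^p <= C' int g^(p-1) |f| = C' int |f|^p v. For p = 1,
   u is a sum of small multiples of the indicators of an exhaustion by bounded
   sets on which 1/v is bounded.
   Conversely, if f lives on a set A of diameter < 1/2, then M f >= int_A |f| on
   A. Testing the inequality with truncations of sigma 1_A, or with the indicator
   of A n {v < eps}, bounds sigma, or 1/v, on A, and finitely many such A cover
   any compact set. *)

Require Import Defs.
From mathcomp Require Import all_boot all_order all_algebra generic_quotient.
From mathcomp Require Import ring lra.
From mathcomp Require Import all_classical all_reals all_analysis.
From mathcomp Require Import measurable_realfun.
Set Implicit Arguments.
Unset Strict Implicit.
Unset Printing Implicit Defensive.
Import Order.TTheory GRing.Theory Num.Theory.
Import numFieldNormedType.Exports.
Local Open Scope classical_set_scope.
Local Open Scope ring_scope.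

(** * Integrals and null sets *)

(** Torus and waveguide are treated at once: [slab N] bounds the coordinates that are not periodic,
    every compact set lies in a slab and every slab in a compact set, and on the torus each slab is
    the whole space. The two conditions on v thus become: v^(-1/(p-1)) is integrable on each slab,
    because p'/p = 1/(p-1), and 1/v is a.e. bounded on each slab. The sigma-algebra is Borel,
    whereas weights and functions are Lebesgue measurable. The analysis is done for Borel functions
    and transferred at the end: a Lebesgue measurable function has a Borel representative off a null
    set, integrals do not see that set, and M f does not change at any point. Tests with sigma use
    truncations because the integral of sigma over A, by which the inequality is divided, is not
    known to be finite beforehand. The interpolation works on dyadic levels, so that only finite
    sums and one monotone limit occur. *)

Lemma bigcup_unpickle (T : Type) (I : countType) (F : I -> set T) :
  \bigcup_i F i = \bigcup_k oapp F set0 (unpickle k).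
Proof.
apply/seteqP; split => [x [i _ Fi]|x [k _]].
  by exists (pickle i) => //; rewrite pickleK.
by case: unpickle => //= i Fi; exists i.
Qed.

Section integral_off_null.
Context d (T : measurableType d) (R : realType) (mu : {measure set T -> \bar R}).
Local Open Scope ereal_scope.
Implicit Types (f g : T -> \bar R) (N D : set T).

Import HBNNSimple.

(* No measurability is needed: the integral of a nonnegative function is a supremum
   over the simple functions below it. *)
Lemma ge0_le_integral_nomeas D f g : (forall x, D x -> 0 <= f x) ->
  (forall x, D x -> f x <= g x) ->
  \int[mu]_(x in D) f x <= \int[mu]_(x in D) g x.
Proof.
move=> f0 fg; rewrite !ge0_integralE//; last first.
  by move=> x Dx; exact: le_trans (f0 x Dx) (fg x Dx).
apply: ge_ereal_sup => _ [h /= hf <-]; apply: ereal_sup_ubound; exists h => //.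
move=> x; apply: le_trans (hf x) _; rewrite !patchE; case: ifPn => //.
by rewrite inE => /fg.
Qed.

(** Multiply [h] by the indicator of the complement of [N]. After this change the simple functions
    below f also lie below any g that dominates f off [N], so integrals of Lebesgue measurable
    functions can be compared up to null sets. *)
Lemma sintegral_off_null N (h : {nnsfun T >-> R}) : measurable N -> mu N = 0 ->
  exists2 k : {nnsfun T >-> R}, sintegral mu k = sintegral mu h &
    forall x, (k x = if x \in N then 0 else h x)%R.
Proof.
move=> mN N0; exists (proj_nnsfun h (measurableC mN)); last first.
  move=> x /=; rewrite mindicE in_setC.
  by case: ifPn; rewrite /= ?mulr0 ?mulr1.
rewrite -!integralT_nnsfun; apply: ge0_ae_eq_integral => //.
- exact/measurable_EFinP.
- exact/measurable_EFinP.
- by move=> x _; rewrite lee_fin.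
- by move=> x _; rewrite lee_fin.
exists N; split => // x /= /not_implyP[_] /=; rewrite mindicE in_setC.
by case: (boolP (x \in N)) => [/set_mem//|_]; rewrite /= mulr1.
Qed.

Lemma ge0_le_integral_off_null N f g : measurable N -> mu N = 0 ->
  (forall x, 0 <= f x) -> (forall x, 0 <= g x) ->
  (forall x, ~ N x -> f x <= g x) -> \int[mu]_x f x <= \int[mu]_x g x.
Proof.
move=> mN N0 f0 g0 fg; rewrite !ge0_integralTE//.
apply: ge_ereal_sup => _ [h /= hf <-].
have [k <- kE] := sintegral_off_null h mN N0.
apply: ereal_sup_ubound; exists k => // x; rewrite kE.
by case: (boolP (x \in N)) => // /negP; rewrite inE => /fg; exact/le_trans/hf.
Qed.

Lemma ge0_eq_integral_off_null N f g : measurable N -> mu N = 0 ->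
  (forall x, 0 <= f x) -> (forall x, 0 <= g x) ->
  (forall x, ~ N x -> f x = g x) -> \int[mu]_x f x = \int[mu]_x g x.
Proof.
move=> mN N0 f0 g0 fg; apply/eqP; rewrite eq_le; apply/andP; split;
  by apply: (ge0_le_integral_off_null mN) => // x /fg ->.
Qed.

End integral_off_null.

Section lebesgue_measurable.
Context d (T : measurableType d) (R : realType) (mu : {measure set T -> \bar R}).
Local Open Scope ereal_scope.

(** Countably many level sets decide measurability: each {f > q} with q rational is Borel up to a
    null set, the union N of these null sets is null, and off N the set {f > r} is the union of the
    {f > q} over q > r. *)
Lemma completed_measurableP (f : T -> \bar R) :
  (forall B : set \bar R, measurable B -> completed_algebra_gen mu (f @^-1` B))
  <-> exists N, [/\ measurable N, mu N = 0 & measurable_fun (~` N) f].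
Proof.
split; last first.
  move=> [N [mN N0 mf]] B mB.
  exists (~` N `&` f @^-1` B); first exact: mf (measurableC mN) B mB.
  exists (N `&` f @^-1` B).
    by exists N; split => //; exact: subIsetl.
  by rewrite -setIUl setvU setTI.
move=> mf.
have H (q : rat) : exists AN : set T * set T, [/\ measurable AN.1,
    measurable AN.2, mu AN.2 = 0 &
    ~` AN.2 `&` f @^-1` `](ratr q)%:E, +oo[ = ~` AN.2 `&` AN.1].
  have [A mA [Z [N [mN N0 ZN]] <-]] := mf _ (emeasurable_itv `](ratr q)%:E, +oo[).
  exists (A, N); split => //=; apply/seteqP; split => x [nN] //=.
    by case=> // /ZN.
  by split => //; left.
have [AN ANP] := choice H.
have mN : measurable (\bigcup_q (AN q).2).
  apply: countable_bigcupT_measurable; first exact: countableP.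
  by move=> q; have [] := ANP q.
exists (\bigcup_q (AN q).2); split => //.
  apply: measure_negligible => //; rewrite bigcup_unpickle.
  apply: negligible_bigcup => k; case: unpickle => [q|] /=.
    by have [_ mNq Nq0 _] := ANP q; exists (AN q).2; split.
  exact: negligible_set0.
move=> mD; apply: (measurability _ (ErealGenOInfty.measurableE R)) => //.
move=> _ [_ [r ->] <-].
rewrite [X in measurable X](_ : _ = ~` (\bigcup_q (AN q).2) `&`
    \bigcup_(q in [set q : rat | (r < ratr q)%R]) (AN q).1).
  apply: measurableI; [exact: measurableC|rewrite bigcup_mkcond].
  apply: countable_bigcupT_measurable; first exact: countableP.
  by move=> q; case: ifP => // _; have [] := ANP q.
apply/seteqP; split => x [/= nN].
  rewrite in_itv/= andbT => rf; split => //.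
  have [q rq qf] : exists2 q : rat, (r < ratr q)%R & (ratr q)%:E < f x.
    move: rf; case: (f x) => [s||] //.
    - rewrite lte_fin => /rat_in_itvoo[q]; rewrite inE/= => /itvP qs.
      by exists q; rewrite ?lte_fin ?qs.
    - move=> _; have /rat_in_itvoo[q] : (r < r + 1)%R by rewrite ltrDl.
      by rewrite inE/= => /itvP qs; exists q; rewrite ?qs// ltry.
  exists q => //; have [_ _ _ E] := ANP q.
  suff : (~` (AN q).2 `&` (AN q).1) x by case.
  rewrite -E; split => //=; first by move=> ?; apply: nN; exists q.
  by rewrite in_itv/= qf.
case=> q /= rq qx; split => //; rewrite in_itv/= andbT.
have [_ _ _ E] := ANP q.
have : (~` (AN q).2 `&` (AN q).1) x.
  by split => // ?; apply: nN; exists q.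
by rewrite -E => -[_ /=]; rewrite in_itv/= andbT; apply: lt_trans; rewrite lte_fin.
Qed.

End lebesgue_measurable.

(** * Lebesgue measure on R^n *)

Lemma lebesgue_measure_translate (R : realType) (a : R) (A : set R) :
  measurable A ->
  lebesgue_measure ((fun x => x + a) @^-1` A) = lebesgue_measure A.
Proof.
move=> mA.
have mt : measurable_fun [set: measurableTypeR R]
    (fun x : measurableTypeR R => x + a : measurableTypeR R).
  exact: measurable_funD.
apply/esym.
rewrite -[RHS]/(pushforward (@lebesgue_measure R)
  (fun x : measurableTypeR R => x + a : measurableTypeR R) A).
apply: lebesgue_measure_unique => //= _ [[b c]] _ <-.
rewrite /pushforward (_ : _ @^-1` _ = `]b - a, c - a]%classic); last first.
  by apply/seteqP; split => x /=; rewrite !in_itv/= lerBrDr ltrBlDr.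
by rewrite !lebesgue_measure_itv/= !lte_fin ltrD2r -!EFinB opprB addrA subrK.
Qed.

Section lebesgue_rV.
Context {R : realType}.
Local Notation L n := (@lebesgue_rV R n).

Lemma rV_consD n (p q : R * 'rV[R]_n) :
  rV_cons (p.1 + q.1, p.2 + q.2) = rV_cons p + rV_cons q.
Proof.
apply/rowP => i; rewrite [RHS]mxE; case: (unliftP ord0 i) => [j|] ->.
  by rewrite !rV_consS mxE.
by rewrite !rV_cons0.
Qed.

Lemma rV_unconsK n : cancel (@rV_uncons R n) (@rV_cons R n).
Proof.
move=> z; apply/rowP => i; case: (unliftP ord0 i) => [j|] ->.
  by rewrite rV_consS mxE.
by rewrite rV_cons0.
Qed.

Lemma measurable_rV_translate n (a : 'rV[R]_n) :
  measurable_fun setT (fun z : 'rV[R]_n => z + a).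
Proof.
apply: measurable_fun_coord => i.
rewrite [X in measurable_fun _ X](_ : _ = fun z : 'rV[R]_n => z ord0 i + a ord0 i).
  by apply: measurable_funD => //; exact: measurable_coord.
by apply/funext => z; rewrite mxE.
Qed.

(** Induction on the dimension: translating both factors of a product measure gives a measure that
    agrees with it on rectangles, hence everywhere. This makes the volume of a ball independent of
    its centre. *)
Lemma lebesgue_rV_translate n (a : 'rV[R]_n) (A : set 'rV[R]_n) :
  measurable A -> L n ((fun z => z + a) @^-1` A) = L n A.
Proof.
elim: n a A => [|n IHn] a A mA.
  congr (L 0 _); apply/seteqP; split => z /=; by rewrite !thinmx0.
set p := rV_uncons a.
pose phi (q : measurableTypeR R * 'rV[R]_n) : measurableTypeR R * 'rV[R]_n :=
  (q.1 + p.1, q.2 + p.2).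
have mphi : measurable_fun setT phi.
  apply/measurable_fun_pairP; split.
    by apply: measurable_funD => //; exact: measurable_fst.
  apply: (measurableT_comp (measurable_rV_translate p.2)).
  exact: measurable_snd.
pose m' : {measure set (measurableTypeR R * 'rV[R]_n) -> \bar R} :=
  measure_function_pushforward__canonical__measure_function_Measure
    (@lebesgue_measure R \x L n)%E mphi.
have mA' : measurable (@rV_cons R n @^-1` A).
  by rewrite -[X in measurable X]setTI; exact: measurable_rV_cons.
rewrite /= /lebesgue_rV_step /pushforward.
transitivity (m' (@rV_cons R n @^-1` A)).
  rewrite /m' /= /pushforward; congr ((_ \x _)%E _).
  apply/seteqP; split => q /=; rewrite /phi rV_consD -/p rV_unconsK;
    by case: q.
apply/esym.
apply: (@product_measure_unique _ _ _ _ R (@lebesgue_measure R) (L n) m' _ _ mA')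
  => B C mB mC.
rewrite /m' /= /pushforward.
rewrite (_ : phi @^-1` _ = ((fun x => x + p.1) @^-1` B) `*`
  ((fun x => x + p.2) @^-1` C))//.
rewrite product_measure1E.
- rewrite IHn//; congr (_ * _)%E; exact: lebesgue_measure_translate mB.
- have mt : measurable_fun [set: measurableTypeR R]
      (fun x : measurableTypeR R => x + p.1 : measurableTypeR R).
    exact: measurable_funD.
  by rewrite -[X in measurable X]setTI; exact: mt.
- by rewrite -[X in measurable X]setTI; exact: measurable_rV_translate.
Qed.

(** The open balls of the sup norm. Their volume is explicit and those with rational data form a
    countable family, so they replace Euclidean balls in the covering argument. *)
Definition cube n (c : 'rV[R]_n) (r : R) : set 'rV[R]_n :=
  [set w | forall i, `|w ord0 i - c ord0 i| < r].

Lemma cubeE n (c : 'rV[R]_n) (r : R) :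
  cube c r = [set w | forall i, `]c ord0 i - r, c ord0 i + r[%classic (w ord0 i)].
Proof.
by apply/seteqP; split => w /= h i; have := h i; rewrite /= in_itv/= ltr_distl.
Qed.

Lemma measurable_box n (A : 'I_n -> set R) : (forall i, measurable (A i)) ->
  measurable [set z : 'rV[R]_n | forall i, A i (z ord0 i)].
Proof.
move=> mA; rewrite (_ : mkset _ = \bigcap_(i in [set: 'I_n])
  ((fun z : 'rV[R]_n => z ord0 i) @^-1` A i)); last first.
  by apply/seteqP; split => z /= zA i *; exact: zA.
apply: fin_bigcap_measurable => //= i _.
by rewrite -[X in measurable X]setTI; exact: measurable_coord.
Qed.

Lemma measurable_cube n (c : 'rV[R]_n) r : measurable (cube c r).
Proof.
rewrite cubeE.
apply: (@measurable_box _ (fun i => `]c ord0 i - r, c ord0 i + r[%classic)) => i.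
exact: measurable_itv.
Qed.

Lemma lebesgue_cube n (c : 'rV[R]_n) r : 0 < r ->
  L n (cube c r) = ((2 * r) ^+ n)%:E.
Proof.
move=> r0; rewrite cubeE.
rewrite (lebesgue_rV_box (A := fun i => `]c ord0 i - r, c ord0 i + r[%classic));
  last by move=> i; exact: measurable_itv.
rewrite (eq_bigr (fun=> (2 * r)%:E)).
  by rewrite prodEFin prodr_const card_ord.
move=> i _; rewrite lebesgue_measure_itv/= lte_fin.
by rewrite ifT; [rewrite -EFinB; congr EFin; lra|lra].
Qed.

Lemma cube_sub n (c e : 'rV[R]_n) (r s : R) :
  (forall i, `|c ord0 i - e ord0 i| + r <= s) -> cube c r `<=` cube e s.
Proof.
move=> ces w wr i; apply: lt_le_trans (ces i).
rewrite -(subrK (c ord0 i) (w ord0 i)) -addrA addrC.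
by apply: le_lt_trans (ler_normD _ _) _; rewrite ltrD2l.
Qed.

Lemma eball_sub_cube n (z : 'rV[R]_n) (r : R) : eball z r `<=` cube z r.
Proof.
move=> w wr i; apply: le_lt_trans wr; rewrite -sqrtr_sqr ler_sqrt.
  by rewrite (bigD1 i)//= lerDl sumr_ge0// => j _; exact: sqr_ge0.
by apply: sumr_ge0 => j _; exact: sqr_ge0.
Qed.

(** The sum of n squares below (r/n)^2 is at most r^2/n; the factor n instead of its square root is
    crude but suffices. The [maxn] keeps the denominator positive in dimension 0. *)
Lemma cube_sub_eball n (z : 'rV[R]_n) (r : R) : 0 < r ->
  cube z (r / (maxn n 1)%:R) `<=` eball z r.
Proof.
move=> r0 w wr; rewrite /eball/=.
rewrite -[ltRHS]ger0_norm ?(ltW r0)// -sqrtr_sqr ltr_sqrt ?exprn_gt0//.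
case: n z w wr => [|n] z w wr; first by rewrite big_ord0 exprn_gt0.
rewrite (maxn_idPl _)// in wr.
apply: (@lt_le_trans _ _ (\sum_(i < n.+1) (r / n.+1%:R) ^+ 2)).
  apply: ltr_sum => [|i _]; first by apply/hasP; exists ord0;
    rewrite ?mem_index_enum.
  by rewrite -[ltLHS]real_normK ?num_real// ltrXn2r// wr.
rewrite sumr_const card_ord -[leLHS]mulr_natr exprMn -mulrA ler_piMr ?sqr_ge0//.
by rewrite exprVn expr2 invfM -mulrA mulVf// mulr1 invf_le1// ler1n.
Qed.

(** Joint measurability in centre and point is what Tonelli's theorem needs for integrals over
    moving balls; the balls themselves are sections. *)
Lemma measurable_eball_graph n (r : R) :
  measurable [set zw : 'rV[R]_n * 'rV[R]_n | eball zw.1 r zw.2].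
Proof.
pose D (zw : 'rV[R]_n * 'rV[R]_n) : R :=
  Num.sqrt (\sum_(i < n) (zw.2 ord0 i - zw.1 ord0 i) ^+ 2).
have mD : measurable_fun setT D.
  apply: (measurableT_comp (f := @Num.sqrt R)).
    by apply: continuous_measurable_fun; exact: sqrt_continuous.
  apply: measurable_sum => i; apply: measurable_funX; apply: measurable_funB.
    exact: measurableT_comp (measurable_coord i) measurable_snd.
  exact: measurableT_comp (measurable_coord i) measurable_fst.
rewrite (_ : mkset _ = D @^-1` `]-oo, r[).
  by rewrite -[X in measurable X]setTI; exact: mD.
by apply/seteqP; split => zw /=; rewrite in_itv.
Qed.

Lemma measurable_eball n (z : 'rV[R]_n) (r : R) : measurable (eball z r).
Proof.
have := measurable_xsection z (@measurable_eball_graph n r).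
congr measurable; apply/seteqP; split => w; rewrite /xsection/= ?inE//.
Qed.

Definition eball_volume n (r : R) : R := fine (L n (eball 0 r)).

Lemma lebesgue_eball_bounds n (z : 'rV[R]_n) (r : R) : 0 < r ->
  (((2 * (r / (maxn n 1)%:R)) ^+ n)%:E <= L n (eball z r) <= ((2 * r) ^+ n)%:E)%E.
Proof.
move=> r0; have r'0 : 0 < r / (maxn n 1)%:R.
  by rewrite divr_gt0// ltr0n leq_max orbT.
rewrite -!(lebesgue_cube z)//; apply/andP; split; apply: le_measure; rewrite ?inE;
  try exact: measurable_cube; try exact: measurable_eball.
- exact: cube_sub_eball.
- exact: eball_sub_cube.
Qed.

Lemma lebesgue_eball n (z : 'rV[R]_n) (r : R) : 0 < r ->
  L n (eball z r) = (eball_volume n r)%:E.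
Proof.
move=> r0; rewrite fineK; last first.
  rewrite ge0_fin_numE//.
  have /andP[_ /le_lt_trans] := lebesgue_eball_bounds (0 : 'rV_n) r0.
  by apply; rewrite ltry.
rewrite -(lebesgue_rV_translate (- z) (measurable_eball 0 r)).
congr (L n _); apply/funext => w; rewrite /eball/preimage/mkset.
by congr (is_true (Num.sqrt _ < r)); apply: eq_bigr => i _; rewrite !mxE subr0.
Qed.

Lemma eball_volume_bounds n (r : R) : 0 < r ->
  (2 * (r / (maxn n 1)%:R)) ^+ n <= eball_volume n r <= (2 * r) ^+ n.
Proof.
by move=> r0; have := lebesgue_eball_bounds (0 : 'rV_n) r0; rewrite lebesgue_eball.
Qed.

Lemma eball_volume_gt0 n (r : R) : 0 < r -> 0 < eball_volume n r.
Proof.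
move=> r0; have /andP[+ _] := eball_volume_bounds n r0; apply: lt_le_trans.
by rewrite exprn_gt0// mulr_gt0// divr_gt0// ltr0n leq_max orbT.
Qed.

Lemma local_maximalE n (rho : R) (f : 'rV[R]_n -> R) (z : 'rV[R]_n) :
  local_maximal rho f z = ereal_sup [set ((eball_volume n r)^-1%:E *
    \int[L n]_(w in eball z r) `|f w|%:E)%E | r in [set r | 0 < r <= rho]].
Proof.
congr ereal_sup; apply: eq_imagel => r /= /andP[r0 _].
by rewrite lebesgue_eball// inver gt_eqF// eball_volume_gt0.
Qed.

End lebesgue_rV.

(** * The weak (1,1) inequality on R^n *)

Lemma measure_bigcup_le d (T : measurableType d) (R : realType)
    (mu : {measure set T -> \bar R}) (F : (set T)^nat) (c : \bar R) :
  (forall k, measurable (F k)) ->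
  (forall N, mu (\big[setU/set0]_(k < N) F k) <= c)%E ->
  (mu (\bigcup_k F k) <= c)%E.
Proof.
move=> mF muF; rewrite -bigcup_bigsetU_bigcup.
pose G N := \big[setU/set0]_(k < N.+1) F k.
have mG N : measurable (G N) by exact: bigsetU_measurable.
have ndG : nondecreasing_seq G.
  by move=> a b ab; apply/subsetPset; exact: subset_bigsetU.
have := nondecreasing_cvg_mu (mu := mu) mG (bigcupT_measurable _ mG) ndG.
move=> /cvg_lim <- //; apply: lime_le; last by apply: nearW => N; exact: muF.
apply: ereal_nondecreasing_is_cvgn => a b ab.
by apply: le_measure; rewrite ?inE//; exact/subsetPset/ndG.
Qed.

Lemma measure_bigsetU_le d (T : measurableType d) (R : realType)
    (mu : {measure set T -> \bar R}) (I : Type) (s : seq I) (F : I -> set T) :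
  (forall i, measurable (F i)) ->
  (mu (\big[setU/set0]_(i <- s) F i) <= \sum_(i <- s) mu (F i))%E.
Proof.
move=> mF; elim: s => [|i s IHs]; first by rewrite !big_nil measure0.
rewrite !big_cons; apply: le_trans (leeD2l _ IHs).
by apply: measureU2 => //; exact: bigsetU_measurable.
Qed.

(* [hit i j] stands for: the balls of index i and j meet. *)
Lemma vitali_selection (R : realType) (I : eqType) (rad : I -> R)
    (hit : I -> I -> Prop) (s : seq I) :
  (forall i, hit i i) -> (forall i j, hit i j -> hit j i) ->
  exists t : seq I, [/\ uniq t, {subset t <= s},
    forall i j, i \in t -> j \in t -> hit i j -> i = j &
    forall i, i \in s -> exists2 j, j \in t & hit i j /\ rad i <= rad j].
Proof.
move=> hitxx hitC; pose LE i j := rad i <= rad j.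
have LE_trans : transitive LE by move=> x y z; exact: le_trans.
wlog : s / sorted LE s.
  have : sorted LE (sort LE s) by apply: sort_sorted => x y; exact: le_total.
  move=> /[swap] /[apply] -[t [ut ts tP sP]]; exists t; split => //.
    by move=> i /ts; rewrite mem_sort.
  by move=> i; rewrite -(mem_sort LE) => /sP.
(* As [s] is sorted by increasing radius, [i] is the smallest ball. It is kept only if it misses all
   balls selected from the tail; otherwise some selected ball that it hits is at least as large. *)
elim: s => [|i s IHs] /=; first by exists [::].
move=> ips; have /allP ile := order_path_min LE_trans ips.
have {IHs}[t [ut ts tP sP]] := IHs (path_sorted ips).
have [[j jt ij]|nhit] := pselect (exists2 j, j \in t & hit i j).
  exists t; split => //.
    by move=> k /ts; rewrite inE => ->; rewrite orbT.
  move=> k; rewrite inE => /predU1P[->|]; last exact: sP.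
  by exists j => //; split => //; exact/ile/ts.
exists (i :: t); split.
- rewrite /= ut andbT; apply/negP => it; apply: nhit; exists i => //.
- by move=> k; rewrite !inE => /predU1P[->|/ts ->]; rewrite ?eqxx ?orbT.
- move=> j k; rewrite !inE => /predU1P[->|jt] /predU1P[->|kt]//.
  + by move=> ik; exfalso; apply: nhit; exists k.
  + by move=> /hitC ij; exfalso; apply: nhit; exists j.
  + exact: tP.
- move=> k; rewrite inE => /predU1P[->|/sP[j jt kj]].
    by exists i; rewrite ?mem_head.
  by exists j; rewrite // inE jt orbT.
Qed.

Section weak_type.
Context {R : realType} {n : nat}.
Local Notation L := (@lebesgue_rV R n).
Implicit Types (g : 'rV[R]_n -> \bar R).
Local Open Scope ereal_scope.

(** The selected cubes are disjoint, so the integrals over them add up to at most the integral of g,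
    and their triples cover all cubes of [s]; tripling multiplies the volume by 3^n. *)
Lemma lebesgue_cubes_le (I : choiceType) (c : I -> 'rV[R]_n) (r : I -> R)
    (s : seq I) g (l : R) :
  (forall i, 0 < r i)%R -> measurable_fun setT g -> (forall z, 0 <= g z) ->
  (0 < l)%R ->
  (forall i, i \in s ->
    l%:E * L (cube (c i) (r i)) <= \int[L]_(z in cube (c i) (r i)) g z) ->
  l%:E * L (\big[setU/set0]_(i <- s) cube (c i) (r i)) <=
  (3 ^+ n)%:E * \int[L]_z g z.
Proof.
move=> r0 mg g0 l0 sP.
have [||t [ut ts tP sel]] := @vitali_selection R I r
  (fun i j => cube (c i) (r i) `&` cube (c j) (r j) !=set0) s.
- by move=> i; exists (c i); split=> k; rewrite subrr normr0.
- by move=> i j; rewrite setIC.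
apply: (@le_trans _ _ ((3 ^+ n)%:E *
    \int[L]_(z in \big[setU/set0]_(i <- t) cube (c i) (r i)) g z)); last first.
  apply: lee_wpmul2l; rewrite ?lee_fin ?exprn_ge0//.
  apply: ge0_subset_integral => //.
  by apply: bigsetU_measurable => i _; exact: measurable_cube.
rewrite ge0_integral_bigsetU//; last 2 first.
- by move=> i; exact: measurable_cube.
- exact: measurable_funTS.
apply: (@le_trans _ _
    (l%:E * L (\big[setU/set0]_(i <- t) cube (c i) (3 * r i)))).
  apply: lee_wpmul2l; rewrite ?lee_fin ?(ltW l0)//.
  apply: le_measure; rewrite ?inE.
  - by apply: bigsetU_measurable => i _; exact: measurable_cube.
  - by apply: bigsetU_measurable => i _; exact: measurable_cube.
  rewrite -!bigcup_seq => w [i /= si wi].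
  have [j jt [[x [xi xj]] rij]] := sel i si.
  (* With w in cube i and x in both cubes, each coordinate satisfies |w - c_j| < 2 r_i + r_j <= 3
     r_j. *)
  exists j => //= k.
  move: (wi k) (xi k) (xj k); rewrite /= !ltr_norml.
  by move=> /andP[? ?] /andP[? ?] /andP[? ?]; apply/andP; split; lra.
apply: (@le_trans _ _ (l%:E * \sum_(i <- t) L (cube (c i) (3 * r i)))).
  apply: lee_wpmul2l; rewrite ?lee_fin ?(ltW l0)//.
  by apply: measure_bigsetU_le => i; exact: measurable_cube.
rewrite !ge0_sume_distrr//; last by move=> i _; exact: integral_ge0.
rewrite [leLHS]big_seq [leRHS]big_seq; apply: lee_sum => i it.
apply: le_trans (lee_wpmul2l _ (sP _ (ts _ it))); rewrite ?lee_fin ?exprn_ge0//.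
rewrite !lebesgue_cube ?mulr_gt0// -!EFinM lee_fin.
have -> : (2 * (3 * r i) = 3 * (2 * r i))%R by ring.
by rewrite exprMn mulrCA.
Qed.

(** The level set is enclosed in the union [A] of the rational cubes on which the average of |f| is
    at least l/K. The union is countable, so [A] is Borel and its measure is controlled by finite
    unions, to which the covering bound applies. *)
Lemma maximal_weak_type : exists2 C : R, (0 < C)%R &
  forall (rho : R) (f : 'rV[R]_n -> R) (l : R), (0 < l)%R ->
    measurable_fun setT f ->
  exists A, [/\ measurable A,
    forall z, l%:E < local_maximal rho f z -> A z &
    l%:E * L A <= C%:E * \int[L]_z `|f z|%:E].
Proof.
(* With m = [maxn n 1], a ball of radius s has volume at least (2s/m)^n, while a cube of half side q
   < 2s has volume at most (4s)^n = (2m)^n (2s/m)^n. *)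
pose K : R := ((2 * (maxn n 1)%:R) ^+ n)%R.
have m0 : (0 < (maxn n 1)%:R :> R)%R by rewrite ltr0n leq_max orbT.
have K0 : (0 < K)%R by rewrite exprn_gt0// mulr_gt0.
exists (3 ^+ n * K)%R; first by rewrite mulr_gt0 ?exprn_gt0.
move=> rho f l l0 mf.
have mg : measurable_fun setT (fun z => `|f z|%:E).
  by apply/measurable_EFinP; exact: measurableT_comp.
pose I := ('rV[rat]_n * rat)%type.
pose c (i : I) : 'rV[R]_n := map_mx ratr i.1.
(* The default 1 makes all radii positive, as the covering bound requires. *)
pose r (i : I) : R := if (0 < i.2)%R then ratr i.2 else 1%R.
have r0 i : (0 < r i)%R by rewrite /r; case: ifP => // ?; rewrite ltr0q.
pose good i := (l / K)%:E * L (cube (c i) (r i)) <=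
  \int[L]_(z in cube (c i) (r i)) `|f z|%:E.
pose D i := if good i then cube (c i) (r i) else set0.
have mD i : measurable (D i).
  by rewrite /D; case: ifP => // _; exact: measurable_cube.
exists (\bigcup_i D i); split.
- rewrite bigcup_unpickle; apply: bigcupT_measurable => k.
  by case: unpickle => /=.
- move=> z; rewrite local_maximalE => /ereal_sup_gt[_ [s /= /andP[s0 _] <-]] avg.
  have /rat_in_itvoo[q] : (s < 2 * s)%R by rewrite ltr_pMl// ltr1n.
  rewrite inE/= => /itvP sq.
  (* With q > s and a centre within q - s of z, the rational cube contains the cube of half side s
     about z, hence the ball. *)
  have H (i : 'I_n) : exists x : rat, (`|z ord0 i - ratr x| < ratr q - s)%R.
    have /rat_in_itvoo[x] :
        (z ord0 i - (ratr q - s) < z ord0 i + (ratr q - s))%R.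
      by have : (0 < ratr q - s)%R; [rewrite subr_gt0 sq|lra].
    by rewrite inE/= => /itvP xP; exists x; rewrite distrC ltr_distl !xP.
  have [x xP] := choice H.
  have q0 : (0 < q)%R by rewrite -(ltr0q R); apply: lt_trans s0 _; rewrite sq.
  pose i : I := (\row_j x j, q).
  have ri : r i = ratr q by rewrite /r /= q0.
  have zi : cube (c i) (r i) z.
    move=> j; rewrite ri !mxE; apply: lt_le_trans (xP j) _.
    by rewrite gerBl ltW.
  have sub : eball z s `<=` cube (c i) (r i).
    apply: subset_trans (@eball_sub_cube _ _ _ _) _.
    apply: cube_sub => j; rewrite !mxE ri.
    by have := xP j; lra.
  exists i => //; rewrite /D ifT//.
  apply: (@le_trans _ _ (\int[L]_(w in eball z s) `|f w|%:E)); last first.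
    apply: ge0_subset_integral => //.
    + exact: measurable_eball.
    + exact: measurable_cube.
    + exact: measurable_funTS.
  rewrite lebesgue_cube//; have := ltW avg.
  rewrite lee_pdivlMl ?eball_volume_gt0// -EFinM; apply: le_trans.
  have /andP[+ _] := eball_volume_bounds n s0.
  rewrite -EFinM lee_fin => Vs.
  rewrite [leRHS]mulrC -mulrA ler_pM2l//; apply: le_trans Vs.
  have : (ratr q < 2 * s)%R by rewrite sq.
  have : (0 < ratr q :> R)%R by rewrite ltr0q.
  rewrite -exprVn -exprMn ri; move: (ratr q : R) => t t0 ts.
  have -> : (2 * (s / (maxn n 1)%:R) = (2 * (maxn n 1)%:R)^-1 * (2 * (2 * s)))%R.
    by field; rewrite gt_eqF.
  have m'0 : (0 <= (2 * (maxn n 1)%:R)^-1 :> R)%R by rewrite invr_ge0 mulr_ge0 ?ltW.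
  by apply: lerXn2r; rewrite ?nnegrE ?mulr_ge0 ?ler_wpM2l ?ltW ?mulr_gt0.
- rewrite bigcup_unpickle.
  suff H : L (\bigcup_k oapp D set0 (unpickle k)) <=
      ((K / l) * 3 ^+ n)%:E * \int[L]_z `|f z|%:E.
    apply: le_trans (lee_wpmul2l _ H) _; rewrite ?lee_fin ?(ltW l0)//.
    rewrite muleA -EFinM (_ : l * (K / l * 3 ^+ n) = 3 ^+ n * K)%R//.
    by field; rewrite gt_eqF.
  apply: measure_bigcup_le => [k|N]; first by case: unpickle => /=.
  pose s := [seq i <- pmap unpickle (iota 0 N) | good i].
  have sP i : i \in s -> (l / K)%:E * L (cube (c i) (r i)) <=
      \int[L]_(z in cube (c i) (r i)) `|f z|%:E.
    by rewrite mem_filter => /andP[].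
  have lK0 : (0 < l / K)%R by rewrite divr_gt0.
  have := lebesgue_cubes_le r0 mg (fun z => normr_ge0 (f z)) lK0 sP.
  rewrite -lee_pdivlMl// invf_div muleA -EFinM; apply: le_trans.
  apply: le_measure; rewrite ?inE.
  + by apply: bigsetU_measurable => k _; case: unpickle => /=.
  + by apply: bigsetU_measurable => i _; exact: measurable_cube.
  rewrite -(bigcup_mkord N (fun k => oapp D set0 (unpickle k))) -bigcup_seq.
  move=> w [k /= kN]; case E : unpickle => [i|]//=; rewrite /D.
  case: ifP => // gi wi; exists i => //=; rewrite mem_filter gi/= mem_pmap.
  by apply/mapP; exists k; rewrite ?mem_iota.
Qed.

End weak_type.

(** * Borel measurability of the local maximal function *)

Section local_maximal_measurable.
Context {R : realType} {n : nat}.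
Local Notation L := (@lebesgue_rV R n).
Local Open Scope ereal_scope.

Lemma measurable_eball_integral (f : 'rV[R]_n -> R) (r : R) :
  measurable_fun setT f ->
  measurable_fun setT (fun z => \int[L]_(w in eball z r) `|f w|%:E).
Proof.
move=> mf; pose G := [set zw : 'rV[R]_n * 'rV[R]_n | eball zw.1 r zw.2].
pose F (zw : 'rV[R]_n * 'rV[R]_n) := ((fun zw => `|f zw.2|%:E) \_ G) zw.
rewrite [X in measurable_fun _ X](_ : _ = fubini_F L F).
  apply: measurable_fun_fubini_tonelli_F.
    apply/(measurable_restrictT _ _).1 => //; first exact: measurable_eball_graph.
    apply: measurable_funTS; apply/measurable_EFinP; apply: measurableT_comp => //.
    by apply: measurableT_comp mf _; exact: measurable_snd.
  by move=> zw; apply: erestrict_ge0.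
apply/funext => z; rewrite integral_mkcond /fubini_F; apply: eq_integral => w _.
by rewrite /F !patchE; congr (if _ then _ else _); apply/idP/idP; rewrite !inE.
Qed.

(** An open ball is the increasing union of concentric smaller ones, so a radius slightly below r
    keeps the integral above t |B(z,r)|, and a rational radius in between has a larger integral and
    a volume below |B(z,r)|. The supremum over all radii thereby becomes countable. *)
Lemma eball_integral_rat (f : 'rV[R]_n -> R) (z : 'rV[R]_n) (t r : R) :
  (0 < r)%R -> measurable_fun setT f ->
  t%:E < (eball_volume n r)^-1%:E * \int[L]_(w in eball z r) `|f w|%:E ->
  exists q : rat, [/\ (0 < ratr q :> R)%R, (ratr q <= r)%R &
  t%:E < (eball_volume n (ratr q))^-1%:E *
    \int[L]_(w in eball z (ratr q)) `|f w|%:E].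
Proof.
(* For t < 0 any rational radius in ]0, r[ works; comparing t |B(z,q)| with t |B(z,r)| below uses t
   >= 0. *)
move=> r0 mf; have [t0 _|t0] := ltP t 0%R.
  have /rat_in_itvoo[q] := r0; rewrite inE/= => /itvP qk.
  have q0 : (0 < ratr q :> R)%R by rewrite qk.
  exists q; split => //; first by rewrite qk.
  apply: lt_le_trans (_ : 0 <= _); first by rewrite lte_fin.
  apply: mule_ge0; last exact: integral_ge0.
  by rewrite lee_fin invr_ge0 ltW// eball_volume_gt0.
have V0 := @eball_volume_gt0 R n r r0.
have mg (A : set 'rV[R]_n) : measurable_fun A (fun z => `|f z|%:E).
  apply: measurable_funTS; apply/measurable_EFinP; exact: measurableT_comp.
rewrite lte_pdivlMl// -EFinM => tI.
pose rk (k : nat) : R := (r - r / k.+1%:R)%R.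
have rkr k : (rk k < r)%R by rewrite /rk ltrBlDr ltrDl divr_gt0.
have UE : \bigcup_k eball z (rk k) = eball z r.
  apply/seteqP; split => w; rewrite /eball/=.
    by move=> [k _ /=] /lt_trans; apply; exact: rkr.
  set s := Num.sqrt _ => sr.
  have sr0 : (0 < (r - s) / r)%R by rewrite divr_gt0// subr_gt0.
  have [k /=] := near_infty_natSinv_lt (PosNum sr0).
  move=> _ /(_ k (leqnn _)) /= kP; exists k => //=.
  rewrite -/s /rk ltrBrDr -ltrBrDl.
  by rewrite -ltr_pdivlMl// mulrC.
have ndB : nondecreasing_seq (fun k => eball z (rk k)).
  move=> a b ab; apply/subsetPset => w /=; rewrite /eball/= => /lt_le_trans; apply.
  rewrite /rk lerD2l lerN2 ler_pM2l// lef_pV2 ?posrE// ler_nat ltnS//.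
have cvgI := @ge0_nondecreasing_set_cvg_integral _ _ _ (fun k => eball z (rk k))
  (fun w => `|f w|%:E) L ndB (fun k => measurable_eball _ _) (fun k => mg _)
  (fun k x _ => normr_ge0 (f x)).
have cvgS := ereal_nondecreasing_cvgn
  (@ge0_nondecreasing_set_nondecreasing_integral _ _ _ (fun k => eball z (rk k))
  (fun w => `|f w|%:E) L ndB (fun k => measurable_eball _ _) (fun k => mg _)
  (fun k x _ => normr_ge0 (f x))).
have E := cvg_unique (@ereal_hausdorff R) cvgI cvgS.
move: tI; rewrite -UE E => /ereal_sup_gt[_ [k _ <-]] tk.
have /rat_in_itvoo[q] := rkr k; rewrite inE/= => /itvP qk.
have q0 : (0 < ratr q :> R)%R.
  apply: (@le_lt_trans _ _ (rk k)); last by rewrite qk.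
  by rewrite /rk subr_ge0 ler_pdivrMr ?ltr0n// ler_peMr ?(ltW r0)// ler1n.
have Vq := eball_volume_gt0 n q0.
exists q; split => //; first by rewrite qk.
rewrite lte_pdivlMl// -EFinM; apply: le_lt_trans (lt_le_trans tk _).
  rewrite lee_fin ler_wpM2r// -lee_fin -!(lebesgue_eball (0 : 'rV_n))//.
  apply: le_measure; rewrite ?inE; try exact: measurable_eball.
  by move=> w; rewrite /eball/= => /lt_le_trans; apply; rewrite qk.
apply: ge0_subset_integral => //; try exact: measurable_eball.
by move=> w; rewrite /eball/= => /lt_le_trans; apply; rewrite qk.
Qed.

Lemma measurable_local_maximal (rho : R) (f : 'rV[R]_n -> R) :
  measurable_fun setT f -> measurable_fun setT (local_maximal rho f).
Proof.
move=> mf; apply: (measurability _ (ErealGenOInfty.measurableE R)).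
move=> _ [_ [t ->] <-]; rewrite setTI.
pose F (q : rat) := if (0 < (ratr q : R) <= rho)%R then
  [set z | t%:E < (eball_volume n (ratr q))^-1%:E *
    \int[L]_(w in eball z (ratr q)) `|f w|%:E] else set0.
rewrite (_ : _ @^-1` _ = \bigcup_q F q).
  apply: countable_bigcupT_measurable; first exact: countableP.
  move=> q; rewrite /F; case: ifP => // _.
  rewrite -[X in measurable X]setTI; apply: emeasurable_fun_o_infty => //.
  by apply: measurable_funeM; exact: measurable_eball_integral.
apply/seteqP; split => z /=; rewrite in_itv/= andbT local_maximalE.
  move=> /ereal_sup_gt[_ [r /= /andP[r0 rrho] <-]] /(eball_integral_rat r0 mf).
  move=> [q [q0 qr qt]]; exists q => //; rewrite /F q0/=.
  by rewrite (le_trans qr).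
move=> [q _]; rewrite /F; case: ifP => // qrho /= /lt_le_trans; apply.
by apply: ereal_sup_ubound; exists (ratr q).
Qed.

End local_maximal_measurable.

(** * Measure and maximal function on the cylinder *)

Lemma ge0_integral_mrestr d (T : measurableType d) (R : realType)
    (mu : {measure set T -> \bar R}) (D : set T) (mD : measurable D)
    (f : T -> \bar R) :
  measurable_fun setT f -> (forall x, 0 <= f x)%E ->
  (\int[mrestr mu mD]_x f x = \int[mu]_(x in D) f x)%E.
Proof.
move=> mf f0; rewrite -(setUv D) ge0_integral_setU//; first last.
- by rewrite disj_set2E setICr.
- exact: measurable_funTS.
- exact: measurableC.
rewrite (eq_measure_integral mu) => [|A mA AD]; last first.
  by rewrite /= /mrestr setIidl.
rewrite [X in (_ + X = _)%E](eq_measure_integral mzero) => [|A mA AD]; last first.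
  rewrite /= /mrestr (_ : A `&` D = set0) ?measure0//.
  by apply/disjoints_subset.
by rewrite integral_measure_zero adde0.
Qed.

Lemma measurable_floor (R : realType) :
  measurable_fun [set: R] (fun x : R => (Num.floor x)%:~R : R).
Proof.
apply: nondecreasing_measurable => // x y xy.
by rewrite ler_int; exact: le_floor.
Qed.

Section cylinder_measure.
Context {R : realType} {n d : nat}.
Local Notation X := (cyl R n d).
Local Notation mu := (@cyl_measure R n d).
Local Notation L := (@lebesgue_rV R d).
Local Notation Q := (@fundamental_domain R n d).
Local Notation pi := (\pi_X : 'rV[R]_d -> X)%qT.

Lemma reduce_repr (x : X) : reduce n (repr x) = repr x.
Proof. by rewrite -repr_pi_cyl reprK. Qed.

Lemma fundamental_repr (x : X) : Q (repr x).
Proof. by rewrite -reduce_repr; exact: reduce_fundamental. Qed.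

Lemma measurable_reduce : measurable_fun setT (@reduce R n d).
Proof.
apply: measurable_fun_coord => i; have mi := @measurable_coord R d i.
case: (boolP (i < n)%N) => ilt.
  rewrite [X in measurable_fun _ X](_ : _ = fun z : 'rV[R]_d =>
      z ord0 i - (Num.floor (z ord0 i + 2^-1))%:~R).
    apply: measurable_funB => //.
    apply: (measurableT_comp (@measurable_floor R)).
    exact: measurable_funD.
  by apply/funext => z; rewrite mxE ilt.
rewrite [X in measurable_fun _ X](_ : _ = fun z : 'rV[R]_d => z ord0 i)//.
by apply/funext => z; rewrite mxE (negbTE ilt).
Qed.

Lemma measurable_repr : measurable_fun setT (repr : X -> 'rV[R]_d).
Proof.
move=> _ A mA; rewrite setTI.
suff : measurable (pi @^-1` (repr @^-1` A)) by [].
rewrite (_ : _ @^-1` _ = @reduce R n d @^-1` A).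
  by rewrite -[X in measurable X]setTI; exact: measurable_reduce.
by apply/seteqP; split => z /=; rewrite repr_pi_cyl.
Qed.

Lemma measurable_cylP (A : set X) :
  measurable A <-> measurable (pi @^-1` A : set 'rV[R]_d).
Proof. by []. Qed.

Lemma ge0_integral_cyl (f : X -> \bar R) :
  measurable_fun setT f -> (forall x, 0 <= f x)%E ->
  (\int[mu]_x f x = \int[L]_(z in Q) f (pi z))%E.
Proof.
move=> mf f0.
rewrite (_ : (\int[mu]_x f x = \int[pushforward
    (mrestr L (@measurable_fundamental_domain R n d)) pi]_x f x)%E)//.
rewrite ge0_integral_pushforward//; last exact: measurable_pi_cyl.
rewrite preimage_setT ge0_integral_mrestr//; last by move=> x; exact: f0.
Qed.

Lemma reduce_translate (z k : 'rV[R]_d) :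
  (forall i : 'I_d, if (i < n)%N then k ord0 i \is a Num.int
                    else k ord0 i == 0) ->
  reduce n (z + k) = reduce n z.
Proof.
move=> kP; apply/rowP => i; rewrite !mxE; have := kP i.
case: ifP => [_ /intrP[a ->]|_ /eqP ->]; last by rewrite addr0.
rewrite (_ : z ord0 i + a%:~R + 2^-1 = z ord0 i + 2^-1 + a%:~R); last by ring.
by rewrite floorDrz ?intr_int// intrKfloor intrD; ring.
Qed.

Lemma pi_reduce (z w : 'rV[R]_d) : reduce n z = reduce n w -> pi z = pi w.
Proof.
move=> zw; rewrite -[LHS]reprK -[RHS]reprK !repr_pi_cyl zw; congr (pi _).
Qed.

(* It contains every ball of radius 1/2 centred in the fundamental domain. *)
Definition unit_tube : set 'rV[R]_d :=
  [set z : 'rV[R]_d | forall i : 'I_d, (i < n)%N -> `|z ord0 i| <= 1].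

Lemma measurable_unit_tube : measurable unit_tube.
Proof.
rewrite (_ : unit_tube = [set z | forall i : 'I_d,
    (if (i < n)%N then `[-1, 1]%classic else setT) (z ord0 i)]).
  apply: (@measurable_box _ _ (fun i : 'I_d =>
    if (i < n)%N then `[-1, 1]%classic else setT)) => i.
  by case: ifP.
apply/seteqP; split => z zT i.
  case: ifP => // ilt; rewrite /= in_itv/= -ler_norml; exact: zT.
by move=> ilt; have := zT i; rewrite ilt /= in_itv/= -ler_norml.
Qed.

(** The translates of the fundamental domain by -1, 0 or 1 in each periodic coordinate cover the
    tube, and each carries exactly the integral of F over the cylinder. Indexing by all coordinates
    gives C = 3^d; the repetitions only enlarge the sum. *)
Lemma ge0_integral_unit_tube : exists2 C : R, 0 < C &
  forall F : X -> \bar R, measurable_fun setT F -> (forall x, 0 <= F x)%E ->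
  (\int[L]_(z in unit_tube) F (pi z) <= C%:E * \int[mu]_x F x)%E.
Proof.
pose I := {ffun 'I_d -> 'I_3}.
pose k (a : I) : 'rV[R]_d := \row_i (if (i < n)%N then (a i)%:R - 1 else 0).
have kP a (i : 'I_d) : if (i < n)%N then k a ord0 i \is a Num.int
                    else k a ord0 i == 0.
  by case: ifP => ilt; rewrite mxE ilt// rpredB// ?rpred1// rpred_nat.
have card_gt0 : 0 < #|{: I}|%:R :> R.
  by rewrite ltr0n; apply/card_gt0P; exists [ffun=> ord0].
exists #|{: I}|%:R => // F mF F0.
have mFpi : measurable_fun setT (fun z => F (pi z)).
  by apply: measurableT_comp => //; exact: measurable_pi_cyl.
have mQ := @measurable_fundamental_domain R n d.
pose Qk a := (fun z => z + (- k a)) @^-1` Q.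
have mQk a : measurable (Qk a).
  by rewrite -[X in measurable X]setTI; exact: measurable_rV_translate.
have cover z : unit_tube z -> exists a, Qk a z.
  (* A nearest integer to z_i is the floor of z_i + 1/2; the entries of [k] are shifted by 1, which
     gives 3/2. *)
  move=> zT; exists [ffun i => inord (Num.truncn (z ord0 i + 3 / 2))].
  move=> i ilt; rewrite !mxE ilt ffunE.
  have /andP[z1 z2] : -1 <= z ord0 i <= 1 by rewrite -ler_norml; exact: zT.
  have h0 : 0 <= z ord0 i + 3 / 2 by lra.
  have /andP[t1 t2] := truncn_itv h0.
  rewrite inordK; first by apply/andP; split; lra.
  rewrite -(ltr_nat R); apply: le_lt_trans t1 _; lra.
have intQk a : (\int[L]_(z in Qk a) F (pi z) = \int[mu]_x F x)%E.
  rewrite ge0_integral_cyl//.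
  transitivity (\int[L]_(z in Qk a) ((F \o pi) \o (fun z => z + - k a)%R) z)%E.
    apply: eq_integral => z _ /=; congr F; apply: pi_reduce.
    rewrite reduce_translate// => i; have := kP a i.
    by case: ifP => ilt; rewrite [in X in _ -> X]mxE ?oppr_eq0// rpredN.
  rewrite -(ge0_integral_pushforward (measurable_rV_translate (- k a)))//.
  - apply: eq_measure_integral; first exact: measurable_rV_translate.
    by move=> ? A mA _; rewrite /= /pushforward lebesgue_rV_translate.
  - exact: measurable_funTS.
  - by move=> y _; exact: F0.
have FQ0 a z : (0 <= ((F \o pi) \_ (Qk a)) z)%E.
  by apply: erestrict_ge0 => w _; exact: F0.
rewrite integral_mkcond.
apply: (@le_trans _ _ (\int[L]_z (\sum_(a : I) ((F \o pi) \_ (Qk a)) z)%E)%E).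
  apply: ge0_le_integral_nomeas => [z _|z _].
    by apply: erestrict_ge0.
  have S0 (P : pred I) : (0 <= \sum_(a : I | P a) ((F \o pi) \_ (Qk a)) z)%E.
    by apply: sume_ge0 => a _; exact: FQ0.
  rewrite patchE; case: ifPn => [|_]; last exact: S0.
  rewrite inE => /cover[a az]; rewrite (bigD1 a)//= patchE mem_set//.
  by rewrite leeDl.
rewrite ge0_integral_sum//.
  rewrite (eq_bigr (fun=> (\int[mu]_x F x)%E)) => [|a _]; last first.
    by rewrite -(intQk a) [RHS]integral_mkcond.
  by rewrite sumr_const mule_natl.
by move=> a; apply/(measurable_restrictT _ _).1 => //; exact: measurable_funTS.
Qed.

End cylinder_measure.

Section cylinder_maximal.
Context {R : realType} {n d : nat}.
Local Notation X := (cyl R n d).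
Local Notation mu := (@cyl_measure R n d).
Local Notation L := (@lebesgue_rV R d).
Local Notation Q := (@fundamental_domain R n d).
Local Notation pi := (\pi_X : 'rV[R]_d -> X)%qT.
Local Notation M := (@cyl_maximal R n d).
Local Open Scope ereal_scope.

Lemma half_gt0 : (0 < 2^-1 :> R)%R. Proof. by rewrite invr_gt0. Qed.

Lemma pi_measurable_comp (f : X -> R) : measurable_fun setT f ->
  measurable_fun setT (f \o pi).
Proof. by move=> mf; apply: measurableT_comp => //; exact: measurable_pi_cyl. Qed.

Lemma measurable_cyl_maximal (f : X -> R) : measurable_fun setT f ->
  measurable_fun setT (M f).
Proof.
move=> mf; apply: (measurableT_comp (f := local_maximal 2^-1 (f \o pi))).
  by apply: measurable_local_maximal; exact: pi_measurable_comp.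
exact: measurable_repr.
Qed.

Lemma cyl_maximal_ge0 (f : X -> R) (x : X) : 0 <= M f x.
Proof.
rewrite /cyl_maximal local_maximalE.
apply: le_trans (ereal_sup_ubound _); last first.
  by exists 2^-1%R => //=; rewrite half_gt0 lexx.
apply: mule_ge0; last exact: integral_ge0.
by rewrite lee_fin invr_ge0 ltW// eball_volume_gt0// half_gt0.
Qed.

Lemma eball_sub (z : 'rV[R]_d) (r s : R) : (r <= s)%R -> eball z r `<=` eball z s.
Proof. by move=> rs w; rewrite /eball/= => /lt_le_trans; exact. Qed.

Lemma eball_sub_unit_tube (x : X) (r : R) : (r <= 2^-1)%R ->
  eball (repr x) r `<=` @unit_tube R n d.
Proof.
move=> r2 w /(eball_sub r2)/eball_sub_cube wx i ilt.
have := wx i; have := fundamental_repr x ilt.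
by rewrite ltr_norml ler_norml => /andP[? ?] /andP[? ?]; apply/andP; split; lra.
Qed.

Lemma le_cyl_maximal (f g : X -> R) (x : X) :
  (forall w, eball (repr x) 2^-1 w -> `|f (pi w)| <= `|g (pi w)|)%R ->
  M f x <= M g x.
Proof.
move=> fg; rewrite /cyl_maximal !local_maximalE; apply: ge_ereal_sup.
move=> _ [r /= /andP[r0 r2] <-]; apply: le_trans (ereal_sup_ubound _); last first.
  by exists r => //=; rewrite r0.
apply: lee_wpmul2l; first by rewrite lee_fin invr_ge0 ltW// eball_volume_gt0.
apply: ge0_le_integral_nomeas => // w wr; rewrite lee_fin; apply: fg.
exact: eball_sub wr.
Qed.

(** Serves the splitting of f at the height t/2 relative to sigma, with h = sigma. *)
Lemma cyl_maximalD (f g h : X -> R) (t : R) (x : X) : (0 <= t)%R ->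
  measurable_fun setT g -> measurable_fun setT h ->
  (forall x, `|f x| <= `|g x| + t * `|h x|)%R ->
  M f x <= M g x + t%:E * M h x.
Proof.
move=> t0 mg mh fgh; rewrite {1}/cyl_maximal local_maximalE.
apply: ge_ereal_sup => _ [r /= r02 <-].
have /andP[r0 r2] := r02.
have V0 : 0 <= (eball_volume d r)^-1%:E.
  by rewrite lee_fin invr_ge0 ltW// eball_volume_gt0.
have mpi (k : X -> R) A : measurable_fun setT k ->
    measurable_fun A (fun w => `|k (pi w)|%:E).
  move=> mk; apply: measurable_funTS; apply/measurable_EFinP.
  by apply: measurableT_comp => //; exact: pi_measurable_comp.
have sup (k : X -> R) : (eball_volume d r)^-1%:E *
    \int[L]_(w in eball (repr x) r) `|k (pi w)|%:E <= M k x.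
  by rewrite /cyl_maximal local_maximalE; apply: ereal_sup_ubound; exists r.
apply: le_trans (leeD (sup g) (lee_wpmul2l _ (sup h))); last by rewrite lee_fin.
rewrite muleCA -muleDr//; last first.
  by rewrite ge0_adde_def// inE ?mule_ge0 ?lee_fin ?integral_ge0.
apply: lee_wpmul2l => //.
rewrite -ge0_integralZl_EFin//; try exact: measurable_eball; try exact: mpi.
rewrite -ge0_integralD//; try exact: measurable_eball; try exact: mpi; first last.
- by apply: measurable_funeM; exact: mpi.
- by move=> w _; rewrite mule_ge0// lee_fin.
by apply: ge0_le_integral_nomeas => // w _; rewrite -EFinM -EFinD lee_fin.
Qed.

Lemma cyl_measureE (A : set X) : mu A = L (pi @^-1` A `&` Q).
Proof. by []. Qed.

(** All balls involved lie in the unit tube, where the periodic lift of a null set is null. Equality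
    holds at every point, so f may be replaced by a Borel representative inside M. *)
Lemma cyl_maximal_eq_off_null (N : set X) (f g : X -> R) (x : X) :
  measurable N -> mu N = 0 -> (forall y, ~ N y -> f y = g y) -> M f x = M g x.
Proof.
move=> mN N0 fg; rewrite /cyl_maximal !local_maximalE.
congr ereal_sup; apply: eq_imagel => r /= /andP[r0 r2]; congr (_ * _).
rewrite integral_mkcond [RHS]integral_mkcond.
have mpiN : measurable (pi @^-1` N : set 'rV[R]_d) by [].
have mT : measurable (eball (repr x) r `&` pi @^-1` N).
  by apply: measurableI => //; exact: measurable_eball.
apply: (ge0_eq_integral_off_null (N := eball (repr x) r `&` pi @^-1` N)) => //.
- have [C C0 CP] := @ge0_integral_unit_tube R n d.
  apply/eqP; rewrite eq_le measure_ge0 andbT.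
  have N1 y : 0 <= (\1_N y : R)%:E by rewrite lee_fin.
  have mN1 : measurable_fun setT (fun y => (\1_N y : R)%:E).
    by apply/measurable_EFinP; exact: measurable_indic.
  have E : \int[mu]_y (\1_N y : R)%:E = 0.
    by rewrite integral_indic// setIT; exact: N0.
  have := CP _ mN1 N1; rewrite E mule0.
  rewrite [X in X <= _](_ : _ = L (pi @^-1` N `&` @unit_tube R n d)); last first.
    exact: (integral_indic L (@measurable_unit_tube R n d) mpiN).
  apply: le_trans; apply: le_measure; rewrite ?inE//.
    by apply: measurableI => //; exact: measurable_unit_tube.
  by move=> w [wr wN]; split => //; exact: eball_sub_unit_tube wr.
- by move=> w; apply: erestrict_ge0.
- by move=> w; apply: erestrict_ge0.
- move=> w nw; rewrite !patchE; case: ifPn => //; rewrite inE => wx.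
  by rewrite /= fg// => piw; exact: nw.
Qed.

(** The ball of radius 1/2 lies in a cube of side 1, so its volume is at most 1 and an average over
    it dominates the integral over A. Distances are those of representatives, so A lifts to a part
    of this ball inside the fundamental domain. *)
Lemma cyl_maximal_ge_average (f : X -> R) (A : set X) (x : X) :
  measurable_fun setT f -> measurable A ->
  (forall y, A y -> eball (repr x) 2^-1 (repr y)) ->
  \int[mu]_(y in A) `|f y|%:E <= M f x.
Proof.
move=> mf mA Ax.
have mfE : measurable_fun setT (EFin \o (fun y => `|f y|%R)).
  by apply/measurable_EFinP; exact: measurableT_comp.
rewrite /cyl_maximal local_maximalE; apply: le_trans (ereal_sup_ubound _); last first.
  by exists 2^-1%R => //=; rewrite half_gt0 lexx.
rewrite integral_mkcond ge0_integral_cyl; last 2 first.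
- exact/(measurable_restrictT _ _).1/measurable_funTS.
- by move=> y; apply: erestrict_ge0.
rewrite lee_pdivlMl ?eball_volume_gt0 ?half_gt0//.
apply: (@le_trans _ _ (\int[L]_(z in Q) ((fun y => `|f y|%:E) \_ A) (pi z))).
  rewrite -[leRHS]mul1e; apply: lee_wpmul2r.
    by apply: integral_ge0 => z _; apply: erestrict_ge0.
  rewrite lee_fin; have /andP[_ /le_trans] := @eball_volume_bounds R d _ half_gt0.
  by apply; rewrite mulfV ?expr1n// gt_eqF.
rewrite integral_mkcond [leRHS]integral_mkcond.
apply: ge0_le_integral_nomeas => z _.
  by apply: erestrict_ge0 => y _; apply: erestrict_ge0.
rewrite [leLHS]patchE; case: ifPn => [|_]; last exact: erestrict_ge0.
rewrite inE => zQ; rewrite patchE; case: ifPn => [|_]; last exact: erestrict_ge0.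
by rewrite inE => /Ax; rewrite repr_pi_cyl reduce_id// => zx; rewrite patchE mem_set.
Qed.

(** At points of the fundamental domain M f sees the lift of f only on the unit tube. Cutting the
    lift off outside the tube keeps its integral within a multiple of that of f, and the inequality
    on R^d applies. *)
Lemma cyl_maximal_weak_type : exists2 C : R, (0 < C)%R &
  forall (f : X -> R) (l : R), (0 < l)%R -> measurable_fun setT f ->
    l%:E * mu [set x | l%:E < M f x] <= C%:E * \int[mu]_x `|f x|%:E.
Proof.
have [C1 C10 C1P] := @ge0_integral_unit_tube R n d.
have [C2 C20 C2P] := @maximal_weak_type R d.
exists (C2 * C1)%R; first by rewrite mulr_gt0.
move=> f l l0 mf.
have mfE : measurable_fun setT (fun x => `|f x|%:E).
  by apply/measurable_EFinP; exact: measurableT_comp.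
pose T := @unit_tube R n d.
have mT : measurable T := @measurable_unit_tube R n d.
pose h := (f \o pi) \_ T.
have mh : measurable_fun setT h.
  apply/(measurable_restrictT _ _).1 => //; apply: measurable_funTS.
  exact: pi_measurable_comp.
have [A [mA AP AC]] := C2P 2^-1%R h l l0 mh.
apply: (@le_trans _ _ (l%:E * L A)).
  apply: lee_wpmul2l; first by rewrite lee_fin ltW.
  rewrite cyl_measureE; apply: le_measure; rewrite ?inE//.
    apply: measurableI; last exact: measurable_fundamental_domain.
    apply: (measurable_cylP _).1; rewrite -[X in measurable X]setTI.
    by apply: emeasurable_fun_o_infty => //; exact: measurable_cyl_maximal.
  move=> z [/= lz zQ]; apply: AP; apply: lt_le_trans lz _.
  rewrite /cyl_maximal repr_pi_cyl reduce_id// !local_maximalE.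
  apply: ge_ereal_sup => _ [r /= /andP[r0 r2] <-].
  apply: le_trans (ereal_sup_ubound _); last by exists r => //=; rewrite r0.
  apply: lee_wpmul2l; first by rewrite lee_fin invr_ge0 ltW// eball_volume_gt0.
  apply: ge0_le_integral_nomeas => // w wr; rewrite lee_fin /h patchE mem_set//.
  have zE : repr (pi z) = z by rewrite repr_pi_cyl reduce_id.
  by rewrite -zE in wr; exact: eball_sub_unit_tube wr.
apply: (le_trans AC); rewrite EFinM -muleA; apply: lee_wpmul2l.
  by rewrite lee_fin ltW.
apply: le_trans (C1P _ mfE _) => //.
rewrite [leRHS]integral_mkcond; apply: ge0_le_integral_nomeas => // z _.
by rewrite /h !patchE; case: ifP => //; rewrite normr0.
Qed.

End cylinder_maximal.

(** * Marcinkiewicz interpolation *)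

Lemma le_poweR (R : realType) (r : R) (x y : \bar R) : (0 <= r)%R ->
  (0 <= x -> x <= y -> x `^ r <= y `^ r)%E.
Proof.
move=> r0 x0 xy; apply: gt0_ler_poweR => //; rewrite in_itv/= leey andbT//.
exact: le_trans xy.
Qed.

Section dyadic_layers.
Context {R : realType} (p : R) (p1 : 1 < p).

Let t (t0 : R) (k : nat) : R := t0 * 2 ^+ k.

Let t_gt0 t0 k : 0 < t0 -> 0 < t t0 k.
Proof. by move=> h; rewrite mulr_gt0// exprn_gt0. Qed.

Let tS t0 k : t t0 k.+1 = 2 * t t0 k.
Proof. by rewrite /t exprS mulrCA. Qed.

(** A discrete form of the layer cake formula: if k is the last level with t_k < T, the truncated
    power is at most t_(k+1)^p, which is a single summand. *)
Lemma truncated_power_le_layers (t0 : R) (J : nat) (T : \bar R) :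
  0 < t0 -> (0 <= T)%E ->
  ((if t0%:E < T then (mine T (t t0 J.+1)%:E) `^ p else 0) <=
   \sum_(k < J.+1) (if (t t0 k)%:E < T then ((t t0 k.+1) `^ p)%:E else 0))%E.
Proof.
move=> t00 T0; elim: J => [|J IHJ].
  rewrite big_ord1 {2}/t expr0 mulr1; case: ifP => // tT.
  rewrite -poweR_EFin; apply: le_poweR.
  - by rewrite ltW// (lt_trans _ p1).
  - by rewrite le_min T0 lee_fin ltW// t_gt0.
  - by rewrite ge_min lexx orbT.
rewrite big_ord_recr/=.
have S0 : (0 <= \sum_(k < J.+1)
    (if (t t0 k)%:E < T then ((t t0 k.+1) `^ p)%:E else 0))%E.
  by apply: sume_ge0 => k _; case: ifP => // _; rewrite lee_fin powR_ge0.
case: (ltP (t t0 J.+1)%:E T) => tT; last first.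
  rewrite adde0; apply: le_trans IHJ.
  have tJ : t t0 J.+1 <= t t0 J.+2.
    by rewrite [leRHS]tS ler_peMl ?ler1n// ltW// t_gt0.
  by case: ifP => // _; rewrite !min_l// (le_trans tT)// lee_fin.
apply: le_trans (leeDr _ S0).
case: ifP => // _; last by rewrite lee_fin powR_ge0.
rewrite -poweR_EFin; apply: le_poweR.
- by rewrite ltW// (lt_trans _ p1).
- by rewrite le_min T0 lee_fin ltW// t_gt0.
- by rewrite ge_min lexx orbT.
Qed.

(** The ratio of the geometric progression t_k^(p-1). *)
Let rho : R := 2 `^ (p - 1).

Lemma rho_gt1 : 1 < rho.
Proof.
have p10 : 0 < p - 1 by rewrite subr_gt0.
have := @gt0_ltr_powR R _ p10 1 2; rewrite powR1 !nnegrE; apply => //.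
by rewrite ltr1n.
Qed.

(** If t_k is the last level below a, then (rho - 1) times the geometric sum up to k is at most
    t_(k+1)^(p-1), and t_(k+1) = 2 t_k < 2 a with 2^(p-1) = rho. *)
Lemma layers_sum_le (t0 a : R) (J : nat) : 0 < t0 -> 0 <= a ->
  (rho - 1) * (\sum_(k < J) (if t t0 k < a then (t t0 k) `^ (p - 1) else 0))
  <= rho * a `^ (p - 1).
Proof.
move=> t00 a0; have rho1 := rho_gt1.
have full J' : (rho - 1) * (\sum_(k < J') (t t0 k) `^ (p - 1)) <= (t t0 J') `^ (p - 1).
  elim: J' => [|J' IH]; first by rewrite big_ord0 mulr0 powR_ge0.
  have tJ0 := ltW (t_gt0 J' t00).
  rewrite big_ord_recr/= mulrDr tS powRM// -/rho.
  by rewrite [leRHS](_ : _ = t t0 J' `^ (p - 1) + (rho - 1) * t t0 J' `^ (p - 1));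
    [rewrite lerD2r|ring].
elim: J => [|J IHJ].
  by rewrite big_ord0 mulr0 mulr_ge0 ?powR_ge0// ltW// (lt_trans _ rho1).
rewrite big_ord_recr/=; case: ifP => [ta|_]; last by rewrite addr0.
apply: (@le_trans _ _ ((rho - 1) * (\sum_(k < J.+1) (t t0 k) `^ (p - 1)))).
  rewrite ler_wpM2l ?subr_ge0 ?(ltW rho1)// big_ord_recr/= lerD2r.
  by apply: ler_sum => k _; case: ifP => // _; rewrite powR_ge0.
have tJ0 := ltW (t_gt0 J t00).
apply: le_trans (full _) _; rewrite tS powRM// -/rho.
rewrite ler_wpM2l ?powR_ge0//; apply: ge0_ler_powR => //.
- by rewrite subr_ge0 ltW.
- exact: ltW.
Qed.

Section interpolation.
Context d (Y : measurableType d) (mu : {measure set Y -> \bar R}).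
Context (T : Y -> \bar R) (F G : Y -> R) (C : R).
Hypotheses (mT : measurable_fun setT T) (T0 : forall x, (0 <= T x)%E).
Hypotheses (mF : measurable_fun setT F) (F0 : forall x, 0 <= F x).
Hypotheses (mG : measurable_fun setT G) (G0 : forall x, 0 <= G x).
Hypothesis C0 : 0 <= C.
(** To be used with T = M f/max(1, M sigma), G = |f| v^(1/(p-1)) and F = |f|, for which G^(p-1) F =
    |f|^p v. *)
Hypothesis weakT : forall s, 0 < s -> (s%:E * mu [set x | s%:E < T x] <=
  C%:E * \int[mu]_(x in [set x | (s < 2 * G x)%R]) (F x)%:E)%E.

(** The factor 2^p comes from t_(k+1) = 2 t_k, rho/(rho - 1) from the geometric sum, and 2^(p-1)
    from the 2 in front of G. *)
Let K : R := C * 2 `^ p * (rho / (rho - 1)) * 2 `^ (p - 1).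

Let K_ge0 : 0 <= K.
Proof.
have r1 := rho_gt1.
by rewrite !mulr_ge0 ?powR_ge0// ?invr_ge0 ?subr_ge0 ltW.
Qed.

Let mlt (s : R) : measurable [set x | (s%:E < T x)%E].
Proof. by rewrite -[X in measurable X]setTI; exact: emeasurable_fun_o_infty. Qed.

Let mltG (s : R) : measurable [set x | s < 2 * G x].
Proof.
rewrite -[X in measurable X]setTI; apply: measurable_fun_ltr => //.
exact: measurable_funM.
Qed.

(** Summing the weak bound over the levels, with weights t_(k+1)^p, and exchanging sum and integral
    leaves at each x a geometric sum over the levels below 2 G(x). *)
Let truncated_strong_type (t0 : R) (J : nat) : 0 < t0 ->
  (\int[mu]_x (if t0%:E < T x then (mine (T x) (t t0 J.+1)%:E) `^ p else 0) <=
   K%:E * \int[mu]_x (G x `^ (p - 1) * F x)%:E)%E.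
Proof.
move=> t00; pose E k := [set x | ((t t0 k)%:E < T x)%E].
have mE k : measurable (E k) := mlt _.
have c0 k : (0 <= ((t t0 k.+1) `^ p)%:E)%E by rewrite lee_fin powR_ge0.
apply: (@le_trans _ _ (\int[mu]_x
    (\sum_(k < J.+1) ((t t0 k.+1) `^ p)%:E * (\1_(E k) x)%:E))%E).
  apply: ge0_le_integral_nomeas => x _.
    by case: ifP => // _; exact: poweR_ge0.
  apply: le_trans (truncated_power_le_layers _ t00 (T0 x)) _.
  apply: lee_sum => k _; rewrite indicE (_ : (x \in E k) = ((t t0 k)%:E < T x)%E).
    by case: ifP => _; rewrite ?mule1 ?mule0.
  by apply/idP/idP; rewrite inE.
rewrite ge0_integral_sum//; last 2 first.
- move=> k; apply: measurable_funeM; apply/measurable_EFinP.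
  exact: measurable_indic.
- by move=> k x _; rewrite mule_ge0// lee_fin.
pose B k := [set x | t t0 k < 2 * G x].
pose b k : R := C * 2 `^ p * (t t0 k) `^ (p - 1).
have mB k : measurable (B k) := mltG _.
have b0 k : 0 <= b k by rewrite !mulr_ge0 ?powR_ge0.
apply: (@le_trans _ _ (\sum_(k < J.+1)
    \int[mu]_x ((b k)%:E * ((F x)%:E * (\1_(B k) x)%:E)))%E).
  apply: lee_sum => k _.
  rewrite ge0_integralZl_EFin ?powR_ge0//; last first.
    by apply/measurable_EFinP; exact: measurable_indic.
  rewrite integral_indic// setIT tS powRM ?(ltW (t_gt0 _ _))//.
  rewrite ge0_integralZl_EFin//; last 2 first.
  - by move=> x _; rewrite mule_ge0// lee_fin.
  - apply: emeasurable_funM; exact/measurable_EFinP.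
  rewrite -(mulr_powRB1 (ltW (t_gt0 k t00)) (lt_trans ltr01 p1)).
  rewrite [X in X%:E](_ : _ = (2 `^ p * t t0 k `^ (p - 1)) * t t0 k); last by ring.
  rewrite EFinM -muleA.
  rewrite [(b k)%:E](_ : _ = (2 `^ p * t t0 k `^ (p - 1))%:E * C%:E)%E; last first.
    by rewrite -EFinM; congr EFin; rewrite /b; ring.
  rewrite -muleA; apply: lee_wpmul2l; first by rewrite lee_fin mulr_ge0 ?powR_ge0.
  apply: le_trans (weakT (t_gt0 k t00)) _.
  apply: lee_wpmul2l; first by rewrite lee_fin.
  rewrite integral_mkcond; apply: ge0_le_integral_nomeas => x _.
    by apply: erestrict_ge0 => y _; rewrite lee_fin.
  rewrite patchE indicE; case: ifPn => [xB|xB].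
    by rewrite mule1.
  by rewrite mule0.
rewrite -ge0_integral_sum//; last 2 first.
- move=> k; apply: measurable_funeM; apply: emeasurable_funM; exact/measurable_EFinP.
- by move=> k x _; rewrite !mule_ge0// lee_fin.
rewrite -ge0_integralZl_EFin//; last 2 first.
- by move=> x _; rewrite lee_fin mulr_ge0// powR_ge0.
- apply/measurable_EFinP; apply: measurable_funM => //.
  by apply: (measurableT_comp (measurable_powR (p - 1))).
apply: ge0_le_integral_nomeas => x _.
  by apply: sume_ge0 => k _; rewrite !mule_ge0// lee_fin.
rewrite (eq_bigr (fun k : 'I_J.+1 =>
  (C * 2 `^ p * F x *
   (if t t0 k < 2 * G x then t t0 k `^ (p - 1) else 0))%:E)); last first.
  move=> k _; rewrite -!EFinM indicE; congr EFin; rewrite /B /b.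
  rewrite (_ : (x \in _) = (t t0 k < 2 * G x)).
    by case: ifP => _; rewrite ?mulr1 ?mulr0//; ring.
  by apply/idP/idP; rewrite inE.
rewrite sumEFin -mulr_sumr lee_fin /K.
have r1 := rho_gt1; have r0 : 0 < rho - 1 by rewrite subr_gt0.
have GG0 : 0 <= 2 * G x by rewrite mulr_ge0.
have := layers_sum_le J.+1 t00 GG0; rewrite mulrC -ler_pdivlMr// => Sle.
apply: le_trans (ler_wpM2l _ Sle) _; first by rewrite !mulr_ge0 ?powR_ge0.
by rewrite powRM// le_eqVlt; apply/orP; left; apply/eqP; ring.
Qed.

Lemma weak_type_interpolation :
  (\int[mu]_x (T x `^ p) <= K%:E * \int[mu]_x (G x `^ (p - 1) * F x)%:E)%E.
Proof.
(* The truncations run from 2^-k to 2^(k+1), that is, over 2k + 1 doublings; they increase to T^p,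
   so monotone convergence removes them. *)
pose t0 (k : nat) : R := (2 ^+ k)^-1.
pose s (k : nat) : R := 2 ^+ k.+1.
have sE k : t (t0 k) (k + k).+1 = s k.
  by rewrite /t /t0 /s -addnS exprD mulKf// expf_neq0.
have t00 k : 0 < t0 k by rewrite invr_gt0 exprn_gt0.
have s0 k : 0 < s k by rewrite exprn_gt0.
have s_ge k : k%:R <= s k.
  rewrite /s -natrX ler_nat; apply: (@leq_trans (2 ^ k)).
    exact/ltnW/ltn_expl.
  by rewrite leq_exp2l.
have p0 : 0 <= p by rewrite ltW// (lt_trans _ p1).
pose Tk k x := (if (t0 k)%:E < T x then (mine (T x) (s k)%:E) `^ p else 0)%E.
have Tk0 k x : (0 <= Tk k x)%E by rewrite /Tk; case: ifP => // _; exact: poweR_ge0.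
have mTk k : measurable_fun setT (Tk k).
  apply: measurable_fun_ifT => //.
    exact: measurable_fun_lte.
  apply: (measurableT_comp (measurable_poweR p)).
  exact: measurable_mine.
have ndTk x : nondecreasing_seq (Tk ^~ x).
  move=> a b ab; rewrite /Tk; case: ifPn => [ta|_]; last exact: Tk0.
  have tb : ((t0 b)%:E < T x)%E.
    apply: le_lt_trans ta; rewrite lee_fin lef_pV2 ?posrE ?exprn_gt0//.
    by rewrite ler_weXn2l// ler1n.
  rewrite tb; apply: le_poweR => //.
    by rewrite le_min T0 lee_fin ltW.
  by rewrite le_min !ge_min lexx/= lee_fin ler_weXn2l ?orbT// ler1n.
have limE x : limn (Tk ^~ x) = ereal_sup (range (Tk ^~ x)).
  by apply/cvg_lim => //; exact: ereal_nondecreasing_cvgn.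
apply: (@le_trans _ _ (\int[mu]_x limn (Tk ^~ x))%E); last first.
  rewrite monotone_convergence//.
  apply: lime_le.
    apply: ereal_nondecreasing_is_cvgn => a b ab.
    by apply: ge0_le_integral_nomeas => // x _; exact: ndTk.
  apply: nearW => k; have := truncated_strong_type (k + k) (t00 k).
  by rewrite sE.
apply: ge0_le_integral_nomeas => x _; first exact: poweR_ge0.
rewrite limE; have Tx0 := T0 x; case E : (T x) => [r||]; last by rewrite E in Tx0.
- have r0 : 0 <= r by rewrite -lee_fin -E.
  have [->|rn0] := eqVneq r 0.
    rewrite poweR0r ?gt_eqF ?(lt_trans _ p1)//.
    by apply: le_trans (Tk0 0 x) _; apply: ereal_sup_ubound; exists 0%N.
  have {}r0 : 0 < r by rewrite lt_def rn0.
  (* Both 2^-k < r and r <= 2^(k+1) are wanted, hence the sum of two bounds. *)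
  pose k := (Num.bound r + Num.bound r^-1)%N.
  have rk : r < k%:R.
    rewrite /k natrD (lt_le_trans (archi_boundP (ltW r0)))// lerDl//.
  have r'k : r^-1 < k%:R.
    have := archi_boundP (ltW (_ : 0 < r^-1)); rewrite invr_gt0 => /(_ r0) h.
    by rewrite /k natrD (lt_le_trans h)// lerDr.
  apply: ereal_sup_ubound; exists k => //; rewrite /Tk E.
  rewrite ifT; last first.
    rewrite lte_fin /t0 invf_plt ?posrE ?exprn_gt0//; apply: lt_le_trans r'k _.
    by rewrite -natrX ler_nat ltnW// ltn_expl.
  by rewrite min_l// lee_fin ltW// (lt_le_trans rk).
- rewrite (_ : ereal_sup _ = +oo%E) ?leey//; apply: eq_infty => r.
  pose k := Num.bound `|r|.
  apply: (@le_trans _ _ (Tk k x)); last by apply: ereal_sup_ubound; exists k.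
  rewrite /Tk E ltry min_r ?leey// poweR_EFin lee_fin.
  have rk : r <= k%:R.
    by apply: le_trans (ler_norm _) _; apply/ltW/archi_boundP.
  apply: le_trans rk (le_trans (s_ge k) _); apply: le1r_powR; last exact: ltW.
  by rewrite /s exprn_ege1// ler1n.
Qed.

End interpolation.

End dyadic_layers.

(** * Sufficiency *)

Lemma bounded_multiples_eq0 (R : realType) (e K : \bar R) :
  (0 <= e -> K < +oo -> (forall l : R, (0 < l)%R -> l%:E * e <= K) -> e = 0)%E.
Proof.
move=> e0 Koo H; have K0 : (0 <= K)%E.
  by apply: le_trans (H 1%R ltr01); rewrite mul1e.
case: K K0 Koo H => [K||]//; rewrite lee_fin => K0 _; case: e e0 => [m||]//.
  rewrite lee_fin => m0 H; congr EFin.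
  apply/eqP; rewrite eq_le m0 andbT leNgt; apply/negP => {}m0.
  have := H ((K + 1) / m)%R; rewrite divr_gt0 ?ltr_wpDl// => /(_ isT).
  by rewrite -EFinM divfK ?gt_eqF// lee_fin; apply/negP; rewrite -ltNge ltrDl.
by move=> _ /(_ 1%R ltr01); rewrite mul1e.
Qed.

Section slabs.
Context {R : realType} {n d : nat}.
Local Notation X := (cyl R n d).
Local Notation mu := (@cyl_measure R n d).
Local Notation L := (@lebesgue_rV R d).
Local Notation pi := (\pi_X : 'rV[R]_d -> X)%qT.
Local Notation M := (@cyl_maximal R n d).

(** Leaving the periodic coordinates free keeps slabs open in the quotient; representatives bound
    those coordinates anyway. *)
Definition slab (N : nat) : set X :=
  [set x : X | forall i : 'I_d, (n <= i)%N -> `|repr x ord0 i| < N%:R].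

Lemma measurable_slab N : measurable (slab N).
Proof.
pose A (i : 'I_d) : set R := if (n <= i)%N then `]- N%:R, N%:R[%classic else setT.
rewrite (_ : slab N = (repr : X -> 'rV[R]_d) @^-1` [set z | forall i, A i (z ord0 i)]).
  rewrite -[X in measurable X]setTI; apply: measurable_repr => //.
  by apply: measurable_box => i; rewrite /A; case: ifP.
apply/seteqP; split => x xN i; rewrite /A/=.
  by case: ifP => // ni; rewrite /= in_itv/= -ltr_norml; exact: xN.
by move=> ni; have := xN i; rewrite /A ni /= in_itv/= -ltr_norml.
Qed.

Lemma nondecreasing_slab : nondecreasing_seq slab.
Proof.
move=> a b ab; apply/subsetPset => x xa i ni; apply: lt_le_trans (xa i ni) _.
by rewrite ler_nat.
Qed.

Lemma bigcup_slab : \bigcup_N slab N = setT.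
Proof.
apply/seteqP; split => // x _.
exists (\max_(i < d) Num.bound `|repr x ord0 i|) => // i ni.
apply: (@lt_le_trans _ _ (Num.bound `|repr x ord0 i|)%:R).
  exact: archi_boundP.
rewrite ler_nat.
exact: leq_bigmax.
Qed.

Lemma slab_subset_box N (x : X) (i : 'I_d) : slab N x ->
  `|repr x ord0 i| < N.+1%:R.
Proof.
move=> xN; have [ilt|ni] := ltnP i n.
  have /andP[h1 h2] := fundamental_repr x ilt.
  rewrite ltr_norml -natr1; have : 0 <= N%:R :> R by [].
  by move=> N0; apply/andP; split; lra.
by apply: lt_le_trans (xN i ni) _; rewrite ler_nat.
Qed.

Lemma slab_eball N (x : X) (w : 'rV[R]_d) :
  slab N x -> eball (repr x) 2^-1 w -> slab N.+1 (pi w).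
Proof.
move=> xN /eball_sub_cube wx i ni; rewrite repr_pi_cyl mxE ltnNge ni/=.
have := wx i; have := xN i ni.
rewrite -[N.+1%:R]natr1 !ltr_norml => /andP[? ?] /andP[? ?]; apply/andP; split; lra.
Qed.

Local Open Scope ereal_scope.

Lemma cyl_maximal_slab (f : X -> R) N (x : X) : slab N x ->
  M f x <= M (f \_ (slab N.+1)) x.
Proof.
move=> xN; apply: le_cyl_maximal => w wx.
by rewrite patchE mem_set//; exact: slab_eball wx.
Qed.

Lemma restr_integral (f : X -> R) (A : set X) :
  \int[mu]_x `|(f \_ A) x|%:E = \int[mu]_(x in A) `|f x|%:E.
Proof.
rewrite [RHS]integral_mkcond; apply: eq_integral => x _.
by rewrite !patchE; case: ifP => //; rewrite normr0.
Qed.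

Lemma measurable_restr (f : X -> R) (A : set X) : measurable A ->
  measurable_fun setT f -> measurable_fun setT (f \_ A).
Proof.
move=> mA mf; apply/(measurable_restrictT _ _).1 => //.
exact: measurable_funTS.
Qed.

(** On [slab N], M f is governed by f on [slab N.+1], where f is integrable. The weak inequality
    then bounds l times the measure of the part of {M f = +oo} in [slab N] by the same finite number
    for every l > 0. *)
Lemma cyl_maximal_pinfty_null (f : X -> R) : measurable_fun setT f ->
  (forall N, \int[mu]_(x in slab N) `|f x|%:E < +oo) ->
  mu [set x | M f x = +oo] = 0.
Proof.
move=> mf fN.
have mE : measurable [set x | M f x = +oo].
  rewrite (_ : [set x | _] = M f @^-1` [set +oo])//.
  by rewrite -[X in measurable X]setTI; exact: measurable_cyl_maximal.
apply: measure_negligible => //.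
rewrite -(setIT [set x | _]) -bigcup_slab setI_bigcupr.
apply: negligible_bigcup => N.
have mEN : measurable ([set x | M f x = +oo] `&` slab N).
  by apply: measurableI => //; exact: measurable_slab.
apply/negligibleP => //.
have [C C0 CP] := @cyl_maximal_weak_type R n d.
have H (l : R) : (0 < l)%R -> l%:E * mu ([set x | M f x = +oo] `&` slab N) <=
    C%:E * \int[mu]_(x in slab N.+1) `|f x|%:E.
  move=> l0; rewrite -restr_integral.
  have mfN := measurable_restr (measurable_slab N.+1) mf.
  apply: le_trans (CP _ _ l0 mfN); apply: lee_wpmul2l; first by rewrite lee_fin ltW.
  apply: le_measure; rewrite ?inE//.
    rewrite -[X in measurable X]setTI; apply: emeasurable_fun_o_infty => //.
    exact: measurable_cyl_maximal.
  move=> x [/= Mx xN]; apply: lt_le_trans (cyl_maximal_slab _ xN).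
  by rewrite Mx ltry.
apply: (bounded_multiples_eq0 _ _ H) => //.
by rewrite lte_mul_pinfty ?lee_fin ?ltW.
Qed.

End slabs.

Section sufficiency.
Context {R : realType} {n d : nat}.
Local Notation X := (cyl R n d).
Local Notation mu := (@cyl_measure R n d).
Local Notation M := (@cyl_maximal R n d).
Local Open Scope ereal_scope.

Lemma strong_type_sufficient (p : R) (v : X -> R) : (1 < p)%R ->
  measurable_fun setT v -> (forall x, 0 < v x)%R ->
  (forall N, \int[mu]_(x in slab N) (v x `^ (- (p - 1)^-1))%:E < +oo) ->
  exists2 w : X -> R, measurable_fun setT w /\ (forall x, 1 <= w x)%R &
  exists2 C : R, (0 <= C)%R & forall f : X -> R, measurable_fun setT f ->
    \int[mu]_x ((M f x * (w x)^-1%:E) `^ p) <=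
    C%:E * \int[mu]_x (`|f x| `^ p * v x)%:E.
Proof.
move=> p1 mv v0 vN; pose s x := (v x `^ (- (p - 1)^-1))%R.
have s0 x : (0 < s x)%R by rewrite powR_gt0.
have ms : measurable_fun setT s by apply: (measurableT_comp (measurable_powR _)).
(* [fine] sends +oo to 0, so w = 1 where M s is infinite; that set is null and is discarded
   below. *)
pose w x := Num.max 1%R (fine (M s x)).
have w1 x : (1 <= w x)%R by rewrite le_max lexx.
have mw : measurable_fun setT w.
  apply: measurable_maxr => //; apply: measurableT_comp => //.
  exact: measurable_cyl_maximal.
exists w => //.
have Mfin : mu [set x | M s x = +oo] = 0.
  apply: cyl_maximal_pinfty_null => // N.
  by under eq_integral do rewrite ger0_norm ?ltW ?s0//.
have mMoo : measurable [set x | M s x = +oo].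
  rewrite (_ : [set x | _] = M s @^-1` [set +oo])//.
  by rewrite -[X in measurable X]setTI; exact: measurable_cyl_maximal.
have [C C0 CP] := @cyl_maximal_weak_type R n d.
(* The interpolation constant for 2 C; the 2 arises because the weak inequality is applied at height
   t/2. *)
exists ((2 * C) * 2 `^ p * (2 `^ (p - 1) / (2 `^ (p - 1) - 1)) * 2 `^ (p - 1))%R.
  have r1 := rho_gt1 p1.
  by rewrite !mulr_ge0 ?powR_ge0 ?invr_ge0 ?subr_ge0 ?ltW.
move=> f mf.
pose G x := (`|f x| * v x `^ (p - 1)^-1)%R; pose F x := `|f x|%R.
have G0 x : (0 <= G x)%R by rewrite mulr_ge0// powR_ge0.
have mF : measurable_fun setT F by exact: measurableT_comp.
have mG : measurable_fun setT G.
  apply: measurable_funM => //.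
  exact: (measurableT_comp (measurable_powR _)).
have mT : measurable_fun setT (fun x => M f x * (w x)^-1%:E).
  apply: emeasurable_funM; first exact: measurable_cyl_maximal.
  apply/measurable_EFinP; under eq_fun do rewrite -powR_inv1 ?(le_trans ler01)//.
  exact: (measurableT_comp (measurable_powR _)).
have T0 x : 0 <= M f x * (w x)^-1%:E.
  by rewrite mule_ge0 ?cyl_maximal_ge0// lee_fin invr_ge0 (le_trans _ (w1 x)).
rewrite [X in _ <= _ * X](eq_integral (fun x => (G x `^ (p - 1) * F x)%:E))
  => [|x _]; last first.
  congr EFin; rewrite /G /F powRM ?powR_ge0// -powRrM mulVf ?subr_eq0 ?gt_eqF//.
  rewrite powRr1 ?(ltW (v0 x))// -(mulr_powRB1 (normr_ge0 (f x)) (lt_trans ltr01 p1)).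
  by ring.
apply: weak_type_interpolation => //.
- by move=> x; rewrite /F.
- by rewrite mulr_ge0// ltW.
move=> t t0.
pose A := [set x | (t < 2 * G x)%R].
have mA : measurable A.
  rewrite -[X in measurable X]setTI; apply: measurable_fun_ltr => //.
  exact: measurable_funM.
pose f1 := f \_ A.
have mf1 : measurable_fun setT f1 by exact: measurable_restr.
(* Off A one has G <= t/2, and |f| = G s because s v^(1/(p-1)) = 1. *)
have ff1 x : (`|f x| <= `|f1 x| + (t / 2) * `|s x|)%R.
  rewrite /f1 patchE; case: ifPn => [_|].
    by rewrite lerDl mulr_ge0// divr_ge0// ltW.
  rewrite notin_setE /A/= => /negP; rewrite -leNgt /G.
  rewrite normr0 add0r (gtr0_norm (s0 x)).
  have sv : (s x * v x `^ (p - 1)^-1 = 1)%R.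
    by rewrite /s powRN mulVf// gt_eqF// powR_gt0.
  move=> h; have /(ler_wpM2r (ltW (s0 x))) := h.
  rewrite [leLHS](_ : _ = 2 * `|f x| * (s x * v x `^ (p - 1)^-1))%R; last by ring.
  by rewrite sv => ?; lra.
(* Where M s is finite, t w < M f1 + (t/2) M s and M s <= w leave M f1 > (t/2) w >= t/2, the last
   step by w >= 1. *)
have sub : [set x | t%:E < M f x * (w x)^-1%:E] `<=`
    [set x | M s x = +oo] `|` [set x | (t / 2)%:E < M f1 x].
  move=> x /= tx.
  have [->|Msx] := eqVneq (M s x) +oo; [by left|right].
  have Mfin_x : M s x \is a fin_num.
    by rewrite ge0_fin_numE ?cyl_maximal_ge0// ltey.
  have Mw : M s x <= (w x)%:E.
    by rewrite -(fineK Mfin_x) lee_fin le_max lexx orbT.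
  have w0 : (0 < w x)%R by rewrite (lt_le_trans _ (w1 x)).
  have := cyl_maximalD x (divr_ge0 (ltW t0) (ler0n R 2)) mf1 ms ff1.
  rewrite muleC lte_pdivlMl// -EFinM in tx.
  move=> /(lt_le_trans tx) h.
  have t20 : (0 <= t / 2)%R by rewrite divr_ge0// ltW.
  have := lt_le_trans h (leeD2l (M f1 x) (lee_wpmul2l (t20 : 0 <= (t / 2)%:E) Mw)).
  rewrite -EFinM -lteBlDr// -EFinB; apply: le_lt_trans.
  rewrite lee_fin.
  have := w1 x; set a := w x => a1.
  rewrite (_ : w x * t - t / 2 * w x = t / 2 * w x)%R; last by rewrite -/a; field.
  by rewrite -/a ler_peMr.
apply: (@le_trans _ _ (t%:E * mu [set x | (t / 2)%:E < M f1 x])).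
  apply: lee_wpmul2l; first by rewrite lee_fin ltW.
  have mM1 : measurable [set x | (t / 2)%:E < M f1 x].
    rewrite -[X in measurable X]setTI; apply: emeasurable_fun_o_infty => //.
    exact: measurable_cyl_maximal.
  apply: (@le_trans _ _ (mu ([set x | M s x = +oo] `|` [set x | (t / 2)%:E < M f1 x]))).
    apply: le_measure; rewrite ?inE//; last exact: measurableU.
    by rewrite -[X in measurable X]setTI; apply: emeasurable_fun_o_infty.
  apply: le_trans (measureU2 _ mMoo mM1) _.
  by rewrite [X in X + _](_ : _ = 0)// add0e.
have t20 : (0 < t / 2)%R by rewrite divr_gt0.
have := CP f1 _ t20 mf1; rewrite restr_integral.
move=> /(lee_wpmul2l (_ : 0 <= 2%:E)); rewrite lee_fin => /(_ (ler0n _ _)).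
by rewrite !muleA -!EFinM (_ : 2 * (t / 2) = t)%R//; field.
Qed.

Lemma weak_type_sufficient (v : X -> R) :
  measurable_fun setT v -> (forall x, 0 < v x)%R ->
  (forall N, exists V : R, mu (slab N `&` [set x | V < (v x)^-1]%R) = 0) ->
  exists2 u : X -> R, measurable_fun setT u /\ (forall x, 0 < u x)%R &
  exists2 C : R, (0 < C)%R & forall (f : X -> R) (l : R), (0 < l)%R ->
    measurable_fun setT f ->
    l%:E * \int[mu]_(x in [set x | l%:E < M f x]) (u x)%:E <=
    C%:E * \int[mu]_x (`|f x| * v x)%:E.
Proof.
move=> mv v0 /choice[V0 V0P].
(* At least 1, so that c_N <= 2^-(N+1) and the series defining U converges. *)
pose V N := Num.max 1%R (V0 N).
have V1 N : (1 <= V N)%R by rewrite le_max lexx.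
have mvV N (r : R) : measurable (slab N `&` [set x | r < (v x)^-1]%R).
  apply: measurableI; first exact: measurable_slab.
  rewrite -[X in measurable X]setTI; apply: measurable_fun_ltr => //.
  under eq_fun do rewrite -powR_inv1 ?ltW//.
  exact: (measurableT_comp (measurable_powR _)).
have VP N : mu (slab N `&` [set x | V N < (v x)^-1]%R) = 0.
  apply: (subset_measure0 _ _ _ (V0P N)) => // x [xN /= h]; split => //=.
  by apply: le_lt_trans h; rewrite le_max lexx orbT.
(* On [slab N], M f is governed by f on [slab N.+1], where |f| <= V_(N+1) |f| v a.e. Dividing by
   V_(N+1) makes the contributions of the slabs a geometric series of sum 1, so the weak type
   constant C is kept. *)
pose c N : R := (2^-1 ^+ N.+1 / V N.+1)%R.
have c0 N : (0 < c N)%R.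
  by rewrite divr_gt0 ?exprn_gt0 ?half_gt0// (lt_le_trans ltr01).
have c_le N : (c N <= 2^-1 ^+ N.+1)%R.
  rewrite ler_pdivrMr ?(lt_le_trans ltr01)// ler_peMr// exprn_ge0.
have geo : \sum_(N <oo) (2^-1 ^+ N.+1 : R)%:E = 1.
  have := @cvg_geometric_eseries_half R 1 0; rewrite expr0 divr1 => /cvg_lim <- //.
  apply: congr_lim; apply/funext => k; rewrite /series/=.
  by apply: eq_bigr => i _; rewrite div1r natrX addn1 -exprVn.
pose U (x : X) := \sum_(N <oo) (c N * \1_(slab N) x)%:E.
have cge0 N := ltW (c0 N).
have Uterm N (x : X) : 0 <= (c N * \1_(slab N) x)%:E by rewrite lee_fin mulr_ge0.
have U1 x : U x <= 1.
  rewrite -geo; apply: lee_nneseries => // N _.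
  by rewrite lee_fin -[leRHS]mulr1; apply: ler_pM.
have Upos x : 0 < U x.
  have [N _ xN] : (\bigcup_N slab N) x by rewrite bigcup_slab.
  apply: lt_le_trans (nneseries_lim_ge N.+1 (fun k _ _ => Uterm k x)).
  rewrite big_nat_recr//=.
  apply: (@lt_le_trans _ _ (c N * \1_(slab N) x)%:E).
    by rewrite indicE mem_set// mulr1 lte_fin.
  by rewrite leeDr// sume_ge0.
have Ufin x : U x \is a fin_num.
  by rewrite ge0_fin_numE ?ltW// (le_lt_trans (U1 x)) ?ltry.
have mterm N : measurable_fun setT (fun x : X => (c N * \1_(slab N) x)%:E).
  apply/measurable_EFinP; apply: measurable_funM => //.
  by apply: measurable_indic; exact: measurable_slab.
have mU : measurable_fun setT U.
  by apply: ge0_emeasurable_sum.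
exists (fun x => fine (U x)).
  split; first exact: measurableT_comp.
  by move=> x; rewrite -lte_fin fineK.
have [C C0 CP] := @cyl_maximal_weak_type R n d.
exists C => // f l l0 mf.
pose E := [set x | l%:E < M f x].
have mE : measurable E.
  rewrite -[X in measurable X]setTI; apply: emeasurable_fun_o_infty => //.
  exact: measurable_cyl_maximal.
pose I := \int[mu]_x (`|f x| * v x)%:E.
have mfv : measurable_fun setT (fun x => (`|f x| * v x)%:E).
  apply/measurable_EFinP; apply: measurable_funM => //.
  exact: measurableT_comp.
have fv0 x : 0 <= (`|f x| * v x)%:E by rewrite lee_fin mulr_ge0// ltW.
have I0 : 0 <= I by exact: integral_ge0.
have key N : l%:E * ((c N)%:E * mu (E `&` slab N)) <= (2^-1 ^+ N.+1)%:E * (C%:E * I).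
  have VN0 : (0 < V N.+1)%R by rewrite (lt_le_trans ltr01).
  have h1 : l%:E * mu (E `&` slab N) <= C%:E * \int[mu]_(x in slab N.+1) `|f x|%:E.
    rewrite -restr_integral; have mfN := measurable_restr (measurable_slab N.+1) mf.
    apply: le_trans (CP _ _ l0 mfN); apply: lee_wpmul2l; first by rewrite lee_fin ltW.
    apply: le_measure; rewrite ?inE.
    - by apply: measurableI => //; exact: measurable_slab.
    - rewrite -[X in measurable X]setTI; apply: emeasurable_fun_o_infty => //.
      exact: measurable_cyl_maximal.
    by move=> x [/= Mx xN]; apply: lt_le_trans (cyl_maximal_slab _ xN).
  have h2 : \int[mu]_(x in slab N.+1) `|f x|%:E <= (V N.+1)%:E * I.
    rewrite integral_mkcond -ge0_integralZl_EFin ?(ltW VN0)//.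
    apply: (ge0_le_integral_off_null (mvV N.+1 (V N.+1)) (VP N.+1)).
    - by move=> x; apply: erestrict_ge0.
    - by move=> x; rewrite mule_ge0// lee_fin ltW.
    move=> x nx; rewrite patchE; case: ifPn => [|_]; last first.
      by rewrite mule_ge0// lee_fin ltW.
    rewrite inE => xN; rewrite -EFinM lee_fin mulrCA ler_peMr//.
    rewrite -ler_pdivrMr// div1r leNgt; apply/negP => h; apply: nx.
    by split.
  rewrite muleCA; apply: (@le_trans _ _ ((c N)%:E * (C%:E * ((V N.+1)%:E * I)))).
    apply: lee_wpmul2l; first by rewrite lee_fin ltW.
    by apply: le_trans h1 _; apply: lee_wpmul2l => //; rewrite lee_fin ltW.
  rewrite !muleA -!EFinM (_ : c N * C * V N.+1 = 2^-1 ^+ N.+1 * C)%R//.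
  by rewrite /c; field; rewrite gt_eqF.
rewrite (eq_integral U) => [|x _]; last by rewrite fineK.
rewrite integral_nneseries//; last by move=> N; exact: measurable_funTS.
rewrite -nneseriesZl//; last by move=> N _; apply: integral_ge0.
have CI0 : 0 <= C%:E * I by rewrite mule_ge0 ?lee_fin ?(ltW C0).
rewrite -/I; have [CIoo|CIoo] := eqVneq (C%:E * I) +oo.
  by rewrite CIoo leey.
rewrite -(fineK (_ : C%:E * I \is a fin_num)); last by rewrite ge0_fin_numE ?ltey.
rewrite -[leRHS]mule1 -geo -nneseriesZl; last first.
  by move=> N _; rewrite lee_fin exprn_ge0.
rewrite fineK; last by rewrite ge0_fin_numE ?ltey.
apply: lee_nneseries => // [N _ _|N _].
  by rewrite mule_ge0 ?lee_fin ?(ltW l0)// integral_ge0.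
rewrite [leRHS]muleC; apply: le_trans (key N).
apply: lee_wpmul2l; first by rewrite lee_fin ltW.
have mS := @measurable_slab R n d N.
under eq_integral do rewrite EFinM.
have mSi : measurable_fun E (fun x : X => (\1_(slab N) x : R)%:E).
  by apply: measurable_funTS; apply/measurable_EFinP; exact: measurable_indic.
rewrite ge0_integralZl_EFin// ?integral_indic 1?setIC//.
Qed.

End sufficiency.

(** * Necessity *)

Section necessity.
Context {R : realType} {n d : nat}.
Local Notation X := (cyl R n d).
Local Notation mu := (@cyl_measure R n d).
Local Notation M := (@cyl_maximal R n d).
Local Open Scope ereal_scope.

(** Closeness is that of representatives: points that are near only across identified faces do not
    count. The grid cells that cover a slab are formed on representatives too. *)
Definition small (A : set X) :=
  forall x y, A x -> A y -> eball (repr x) 2^-1 (repr y).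

Lemma small_lty (A : set X) : measurable A -> small A -> mu A < +oo.
Proof.
move=> mA sA; have [->|/set0P[x Ax]] := eqVneq A set0; first by rewrite measure0 ltry.
apply: (@le_lt_trans _ _ (lebesgue_rV d (eball (repr x) 2^-1))); last first.
  by rewrite lebesgue_eball ?half_gt0// ltry.
rewrite cyl_measureE; apply: le_measure; rewrite ?inE.
- by apply: measurableI => //; exact: measurable_fundamental_domain.
- exact: measurable_eball.
by move=> z [/= Az zQ]; have := sA _ _ Ax Az; rewrite repr_pi_cyl reduce_id.
Qed.

(** The integral of u over A may be infinite; a real lower bound e is something one can divide
    by. *)
Lemma integral_gt0 (A : set X) (u : X -> R) : measurable A -> 0 < mu A ->
  measurable_fun setT u -> (forall x, 0 < u x)%R ->
  exists2 e : R, (0 < e)%R & e%:E <= \int[mu]_(x in A) (u x)%:E.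
Proof.
move=> mA A0 mu_ u0; set I := \int[mu]_(x in A) _.
have I0 : 0 <= I by apply: integral_ge0 => x _; rewrite lee_fin ltW.
have In0 : I != 0.
  apply/eqP => IE; move: A0; rewrite lt0e => /andP[/eqP + _]; apply.
  have mE : measurable_fun A (fun x => (u x)%:E).
    by apply: measurable_funTS; exact/measurable_EFinP.
  have : \int[mu]_(x in A) `|(u x)%:E| = 0.
    by rewrite -[RHS]IE; apply: eq_integral => x _; rewrite gee0_abs// lee_fin ltW.
  move/(ae_eq_integral_abs _ mA mE) => [N [mN N0 NP]].
  apply: (subset_measure0 mA mN _ N0) => // x Ax; apply: NP => /= /(_ Ax) [].
  by apply/eqP; rewrite gt_eqF.
case E : I I0 In0 => [r||]//.
  by rewrite lee_fin eqe => r0 rn0; exists r => //; rewrite lt_def rn0.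
by move=> _ _; exists 1%R => //; rewrite leey.
Qed.

Lemma strong_type_necessary (p : R) (v u : X -> R) (C : R) (A : set X) :
  (1 < p)%R -> measurable_fun setT v -> (forall x, 0 < v x)%R ->
  measurable_fun setT u -> (forall x, 0 < u x)%R ->
  (forall f : X -> R, measurable_fun setT f ->
    \int[mu]_x (`|f x| `^ p * v x)%:E < +oo ->
    \int[mu]_x ((M f x `^ p) * (u x)%:E) <=
      C%:E * \int[mu]_x (`|f x| `^ p * v x)%:E) ->
  measurable A -> small A ->
  \int[mu]_(x in A) (v x `^ (- (p - 1)^-1))%:E < +oo.
Proof.
move=> p1 mv v0 mu_ u0 MC mA sA.
pose s x := (v x `^ (- (p - 1)^-1))%R.
have s0 x : (0 < s x)%R by rewrite powR_gt0.
have ms : measurable_fun setT s by apply: (measurableT_comp (measurable_powR _)).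
have msE B : measurable_fun B (fun x => (s x)%:E).
  by apply: measurable_funTS; exact/measurable_EFinP.
have [muA0|muA] := eqVneq (mu A) 0.
  have : \int[mu]_(x in A) `|(s x)%:E| = 0 by apply: integral_abs_eq0.
  under eq_integral do rewrite gee0_abs ?lee_fin ?(ltW (s0 _))//.
  by move=> ->; rewrite ltry.
have [e e0 eA] : exists2 e : R, (0 < e)%R & e%:E <= \int[mu]_(x in A) (u x)%:E.
  by apply: integral_gt0 => //; rewrite lt0e muA measure_ge0.
(* s is bounded on [A_ k] and A has finite measure, so [I k] is finite; the aim is a bound on [I k]
   that does not depend on k. *)
pose A_ k := A `&` [set x | s x <= k%:R]%R.
have mA_ k : measurable (A_ k).
  apply: measurableI => //; rewrite -[X in measurable X]setTI.
  exact: measurable_fun_ler.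
pose I k := \int[mu]_(x in A_ k) (s x)%:E.
have I0 k : 0 <= I k by apply: integral_ge0 => x _; rewrite lee_fin ltW.
have Ioo k : I k < +oo.
  apply: (@le_lt_trans _ _ (\int[mu]_(x in A_ k) (cst k%:R%:E x))).
    apply: ge0_le_integral_nomeas => x; first by rewrite lee_fin ltW.
    by case=> _ /=; rewrite lee_fin.
  rewrite integral_cst//; apply: lte_mul_pinfty; rewrite ?lee_fin//.
  apply: le_lt_trans (small_lty mA sA); apply: le_measure; rewrite ?inE//.
  by move=> x [].
(* This identity singles out sigma: the right-hand side of the inequality becomes the very integral
   that bounds M f from below. In exponents, -p/(p-1) + 1 = -1/(p-1). *)
have spv x : (s x `^ p * v x = s x)%R.
  rewrite -powRrM -[X in (_ * X)%R](powRr1 (ltW (v0 x))) -powRD; last first.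
    by apply/implyP => _; rewrite gt_eqF.
  congr (_ `^ _)%R; field; rewrite subr_eq0 gt_eqF//.
have bound k : e%:E * I k `^ p <= C%:E * I k.
  pose f := s \_ (A_ k).
  have mf : measurable_fun setT f by exact: measurable_restr.
  have fE : \int[mu]_x (`|f x| `^ p * v x)%:E = I k.
    rewrite /I [RHS]integral_mkcond; apply: eq_integral => x _.
    rewrite /f !patchE; case: ifP => _; first by rewrite ger0_norm ?ltW// spv.
    by rewrite normr0 powR0 ?mul0r// gt_eqF// (lt_trans _ p1).
  have := MC f mf; rewrite fE => /(_ (Ioo k)); apply: le_trans.
  apply: (@le_trans _ _ (\int[mu]_(x in A) (I k `^ p * (u x)%:E))).
    rewrite -(fineK (_ : I k `^ p \is a fin_num)); last first.
      by rewrite fin_num_poweR// ge0_fin_numE.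
    rewrite ge0_integralZl_EFin//; last 3 first.
    - by move=> x _; rewrite lee_fin ltW.
    - by apply: measurable_funTS; exact/measurable_EFinP.
    - by rewrite fine_ge0// poweR_ge0.
    by rewrite muleC; apply: lee_wpmul2l => //; rewrite lee_fin fine_ge0// poweR_ge0.
  rewrite integral_mkcond; apply: ge0_le_integral_nomeas => x _.
    by apply: erestrict_ge0 => y _; rewrite mule_ge0 ?poweR_ge0// lee_fin ltW.
  have rhs0 : 0 <= M f x `^ p * (u x)%:E by rewrite mule_ge0 ?poweR_ge0// lee_fin ltW.
  rewrite [leLHS]patchE; case: ifPn => [|_]; last exact: rhs0.
  rewrite inE => Ax; apply: lee_wpmul2r; first by rewrite lee_fin ltW.
  apply: le_poweR => //; first by rewrite ltW// (lt_trans _ p1).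
  rewrite (_ : I k = \int[mu]_(y in A) `|f y|%:E); last first.
    rewrite /I integral_mkcond [RHS]integral_mkcond; apply: eq_integral => y _.
    rewrite /f !patchE /A_ in_setI; case: (y \in A) => //=.
    by case: ifP => _; rewrite ?normr0// ger0_norm// ltW.
  by apply: cyl_maximal_ge_average => // y; exact: sA.
have p10 : (0 < p - 1)%R by rewrite subr_gt0.
(* Dividing e I^p <= C I by I gives I^(p-1) <= C/e. The maximum with 0 is there because C is an
   arbitrary real. *)
have IB k : I k <= ((Num.max 0 C / e) `^ (p - 1)^-1)%:E.
  have Ifin : I k \is a fin_num by rewrite ge0_fin_numE.
  have := bound k; have := I0 k; rewrite -(fineK Ifin).
  move: (fine (I k)) => r; rewrite poweR_EFin -!EFinM !lee_fin => r0.
  have [->|rn0] := eqVneq r 0%R; first by rewrite powR_ge0.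
  have {}r0 : (0 < r)%R by rewrite lt_def rn0.
  rewrite -(mulr_powRB1 (ltW r0) (lt_trans ltr01 p1)) mulrCA [leRHS]mulrC ler_pM2l//.
  move=> rC; have {}rC : (r `^ (p - 1) <= Num.max 0 C / e)%R.
    by rewrite ler_pdivlMr// mulrC (le_trans rC)// le_max lexx orbT.
  have -> : r = ((r `^ (p - 1)) `^ (p - 1)^-1)%R.
    by rewrite -powRrM mulfV ?gt_eqF// powRr1// ltW.
  apply: ge0_ler_powR; rewrite ?nnegrE ?powR_ge0//.
  - by rewrite invr_ge0 ltW.
  - by rewrite divr_ge0 ?le_max ?lexx// ltW.
have UE : \bigcup_k A_ k = A.
  apply/seteqP; split => [x [k _ []]//|x Ax].
  exists (Num.bound (s x)) => //; split => //=.
  by apply/ltW/archi_boundP/ltW.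
rewrite -UE.
have ndA : nondecreasing_seq A_.
  move=> a b ab; apply/subsetPset => x [Ax /= h]; split => //=.
  by apply: le_trans h _; rewrite ler_nat.
have := @ge0_nondecreasing_set_cvg_integral _ _ _ A_ (fun x => (s x)%:E) mu ndA mA_
  (fun k => msE _) (fun k x _ => ltW (s0 x)).
move=> /cvg_lim <- //.
apply: (@le_lt_trans _ _ ((Num.max 0 C / e) `^ (p - 1)^-1)%:E); last by rewrite ltry.
apply: lime_le; last by apply: nearW.
apply: ereal_nondecreasing_is_cvgn.
exact: (@ge0_nondecreasing_set_nondecreasing_integral _ _ _ A_ (fun x => (s x)%:E)
  mu ndA mA_ (fun k => msE _) (fun k x _ => ltW (s0 x))).
Qed.

Lemma weak_type_necessary (v u : X -> R) (C : R) (A : set X) :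
  measurable_fun setT v -> (forall x, 0 < v x)%R ->
  measurable_fun setT u -> (forall x, 0 < u x)%R ->
  (0 < C)%R ->
  (forall (f : X -> R) (l : R), (0 < l)%R -> measurable_fun setT f ->
    \int[mu]_x (`|f x| * v x)%:E < +oo ->
    l%:E * \int[mu]_(x in [set x | l%:E < M f x]) (u x)%:E <=
      C%:E * \int[mu]_x (`|f x| * v x)%:E) ->
  measurable A -> small A ->
  exists V : R, mu (A `&` [set x | V < (v x)^-1]%R) = 0.
Proof.
move=> mv v0 mu_ u0 C0 MC mA sA.
have mE V : measurable (A `&` [set x | V < (v x)^-1]%R).
  apply: measurableI => //; rewrite -[X in measurable X]setTI.
  apply: measurable_fun_ltr => //.
  under eq_fun do rewrite -powR_inv1 ?ltW//.
  exact: (measurableT_comp (measurable_powR _)).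
have [muA0|muA] := eqVneq (mu A) 0.
  by exists 0%R; apply: (subset_measure0 (mE _) mA _ muA0) => x [].
have [e e0 eA] : exists2 e : R, (0 < e)%R & e%:E <= \int[mu]_(x in A) (u x)%:E.
  by apply: integral_gt0 => //; rewrite lt0e muA measure_ge0.
(* With m = mu E and f = 1_E, the inequality at height m/2 < m gives (m/2) e <= C (e/(4C)) m = e
   m/4, which is absurd for m > 0. *)
exists (4 * C / e)%R; set E := _ `&` _.
have {}mE : measurable E by exact: mE.
apply/eqP; apply: contraT => muE.
have muEoo : mu E < +oo.
  apply: le_lt_trans (small_lty mA sA); apply: le_measure; rewrite ?inE//.
  by move=> x [].
have muEfin : mu E \is a fin_num by rewrite ge0_fin_numE.
pose m := fine (mu E).
have m0 : (0 < m)%R by rewrite -lte_fin fineK// lt0e muE measure_ge0.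
pose f : X -> R := \1_E.
have mf : measurable_fun setT f by exact: measurable_indic.
have fv : \int[mu]_x (`|f x| * v x)%:E <= (e / (4 * C) * m)%:E.
  have k0 : (0 <= e / (4 * C))%R by rewrite divr_ge0 ?mulr_ge0 ?(ltW C0) ?(ltW e0).
  apply: (@le_trans _ _ (\int[mu]_x ((e / (4 * C))%:E * (\1_E x)%:E))); last first.
    rewrite ge0_integralZl_EFin//; last first.
      by apply/measurable_EFinP; exact: measurable_indic.
    by rewrite integral_indic// setIT [leRHS]EFinM (fineK muEfin : m%:E = mu E).
  apply: ge0_le_integral_nomeas => x _; first by rewrite lee_fin mulr_ge0 ?(ltW (v0 x)).
  rewrite -EFinM lee_fin /f indicE; case: (boolP (x \in E)) => [|_]; last first.
    by rewrite normr0 mul0r mulr0.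
  rewrite inE => -[_ /= h]; rewrite normr1 mul1r mulr1.
  rewrite -[v x]invrK -[(e / _)%R]invrK lef_pV2 ?posrE ?invr_gt0 ?divr_gt0 ?mulr_gt0//.
  by rewrite invf_div ltW.
have m20 : (0 < m / 2)%R by rewrite divr_gt0.
have := MC f _ m20 mf (le_lt_trans fv (ltry _)).
move=> h; have {}h := le_trans h (lee_wpmul2l (ltW C0 : 0 <= C%:E) fv).
have : (m / 2 * e)%:E <= (C * (e / (4 * C) * m))%:E.
  rewrite [leRHS]EFinM; apply: le_trans h; rewrite EFinM; apply: lee_wpmul2l.
    by rewrite lee_fin ltW.
  apply: (le_trans eA); apply: ge0_subset_integral => //.
  - rewrite -[X in measurable X]setTI; apply: emeasurable_fun_o_infty => //.
    exact: measurable_cyl_maximal.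
  - by apply: measurable_funTS; exact/measurable_EFinP.
  - by move=> x _; rewrite lee_fin ltW.
  move=> x Ax /=; apply: lt_le_trans (cyl_maximal_ge_average mf mE _); last first.
    by move=> y [Ay _]; exact: sA.
  rewrite (eq_integral (fun x => (\1_E x)%:E)) => [|y _]; last first.
    by rewrite ger0_norm.
  have -> : \int[mu]_(y in E) (\1_E y : R)%:E = m%:E.
    by rewrite integral_indic// setIid fineK.
  rewrite lte_fin.
  by rewrite ltr_pdivrMr// ltr_pMr// ltr1n.
rewrite lee_fin (_ : C * (e / (4 * C) * m) = e * m / 4)%R; last first.
  by field; rewrite gt_eqF.
by have := mulr_gt0 m0 e0; move=> ?; rewrite leNgt => /negP[]; lra.
Qed.

End necessity.

(** * Covering a slab by finitely many small sets *)

Section small_cover.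
Context {R : realType} {n d : nat}.
Local Notation X := (cyl R n d).
Local Notation mu := (@cyl_measure R n d).
Local Notation M := (@cyl_maximal R n d).
Local Open Scope ereal_scope.

(** A grid of mesh 1/K on representatives: the cube of half side 1/K = (1/2)/max(d,1) lies in the
    Euclidean ball of radius 1/2. On [slab N] all coordinates lie in ]-(N+1), N+1[, which takes 2
    (N+1) K cells per axis. *)
Lemma slab_small_cover N : exists (I : finType) (A : I -> set X),
  [/\ forall i, measurable (A i), forall i, small (A i) &
      slab N `<=` \bigcup_i A i].
Proof.
pose K := (2 * maxn d 1)%N.
have K0 : (0 < K%:R :> R)%R by rewrite ltr0n muln_gt0/= leq_max orbT.
pose m := (2 * N.+1 * K)%N.
pose B (j : 'I_m) : set R :=
  `[(j%:R / K%:R - N.+1%:R)%R, (j.+1%:R / K%:R - N.+1%:R)%R[%classic.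
pose I := {ffun 'I_d -> 'I_m}.
pose A (a : I) : set X := (repr : X -> 'rV[R]_d) @^-1`
  [set z | forall i, B (a i) (z ord0 i)].
exists I, A; split.
- move=> a; rewrite -[X in measurable X]setTI; apply: measurable_repr => //.
  by apply: (@measurable_box _ _ (fun i => B (a i))) => i; exact: measurable_itv.
- move=> a x y xa ya; apply: cube_sub_eball; first exact: half_gt0.
  move=> i; have := xa i; have := ya i; rewrite /B /= !in_itv/=.
  have -> : (2^-1 / (maxn d 1)%:R = K%:R^-1 :> R)%R by rewrite /K natrM invfM.
  rewrite -(natr1 (a i)) mulrDl mul1r => /andP[? ?] /andP[? ?].
  by rewrite ltr_norml; apply/andP; split; lra.
- move=> x xN.
  have H (i : 'I_d) : exists j : 'I_m, B j (repr x ord0 i).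
    have := slab_subset_box i xN; rewrite ltr_norml => /andP[h1 h2].
    have h0 : (0 <= (repr x ord0 i + N.+1%:R) * K%:R)%R.
      by rewrite mulr_ge0 ?(ltW K0)//; lra.
    have /andP[t1 t2] := truncn_itv h0.
    have jm : (Num.truncn ((repr x ord0 i + N.+1%:R) * K%:R) < m)%N.
      rewrite -(ltr_nat R); apply: le_lt_trans t1 _.
      by rewrite /m natrM ltr_pM2r// natrM; lra.
    exists (Ordinal jm); rewrite /B /= in_itv/=; apply/andP; split.
      by rewrite lerBlDr ler_pdivrMr.
    by rewrite ltrBrDr ltr_pdivlMr.
  have [j jP] := choice H.
  by exists [ffun i => j i] => // i; rewrite ffunE.
Qed.

Lemma slab_integral_lty (s : X -> R) : measurable_fun setT s ->
  (forall x, 0 <= s x)%R ->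
  (forall A : set X, measurable A -> small A ->
    \int[mu]_(x in A) (s x)%:E < +oo) ->
  forall N, \int[mu]_(x in slab N) (s x)%:E < +oo.
Proof.
move=> ms s0 sA N; have [I [A [mA smA sub]]] := slab_small_cover N.
have sA0 i x : 0 <= ((fun x => (s x)%:E) \_ (A i)) x.
  by apply: erestrict_ge0 => y _; rewrite lee_fin.
apply: (@le_lt_trans _ _ (\sum_(i : I) \int[mu]_(x in A i) (s x)%:E)); last first.
  by apply: lte_sum_pinfty => i _; exact: sA.
under eq_bigr do rewrite integral_mkcond.
rewrite -ge0_integral_sum//; last first.
  move=> i; apply/(measurable_restrictT _ _).1 => //.
  by apply: measurable_funTS; exact/measurable_EFinP.
rewrite [leLHS]integral_mkcond; apply: ge0_le_integral_nomeas => x _.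
  by apply: erestrict_ge0 => y _; rewrite lee_fin.
have S0 (P : pred I) : 0 <= \sum_(i : I | P i) ((fun x => (s x)%:E) \_ (A i)) x.
  exact: sume_ge0.
rewrite [leLHS]patchE; case: ifPn => [|_]; last exact: S0.
rewrite inE => /sub[i _ xi]; rewrite (bigD1 i)//= patchE mem_set//.
by rewrite leeDl.
Qed.

Lemma slab_bounded (g : X -> R) : measurable_fun setT g ->
  (forall A : set X, measurable A -> small A ->
    exists V : R, mu (A `&` [set x | V < g x]%R) = 0) ->
  forall N, exists V : R, mu (slab N `&` [set x | V < g x]%R) = 0.
Proof.
move=> mg gA N; have [I [A [mA smA sub]]] := slab_small_cover N.
have [V VP] := choice (fun i => gA (A i) (mA i) (smA i)).
have mlt B r : measurable B -> measurable (B `&` [set x : X | r < g x]%R).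
  move=> mB; apply: measurableI => //; rewrite -[X in measurable X]setTI.
  exact: measurable_fun_ltr.
exists (\sum_(i : I) `|V i|)%R; apply/eqP; rewrite eq_le measure_ge0 andbT.
apply: (@le_trans _ _ (mu (\big[setU/set0]_(i <- enum I)
    (A i `&` [set x | V i < g x]%R)))).
  apply: le_measure; rewrite ?inE.
  - by apply: mlt; exact: measurable_slab.
  - by apply: bigsetU_measurable => i _; exact: mlt.
  rewrite -bigcup_seq => x [/sub[i _ xi] /= gx]; exists i; first by rewrite /= mem_enum.
  split => //=; apply: le_lt_trans gx; apply: le_trans (ler_norm _) _.
  by rewrite (bigD1 i)//= lerDl sumr_ge0.
apply: le_trans (measure_bigsetU_le _ _ _) _ => [i|]; first exact: mlt.
by rewrite big1// => i _; exact: VP.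
Qed.

End small_cover.

(** * Lebesgue measurable weights *)

Section weighted_norms.
Context {R : realType} {n d : nat}.
Local Notation X := (cyl R n d).
Local Notation mu := (@cyl_measure R n d).
Local Notation M := (@cyl_maximal R n d).
Local Open Scope ereal_scope.

(** The value c on the null set is chosen by the user: 1 keeps a weight positive everywhere, 0 is
    taken for functions. *)
Lemma borel_representative (f : X -> R) (c : R) :
  lebesgue_measurable_fun (EFin \o f) ->
  exists (f' : X -> R) (N : set X), [/\ measurable_fun setT f', measurable N,
    mu N = 0, (forall x, ~ N x -> f' x = f x) & (forall x, N x -> f' x = c)].
Proof.
move=> /completed_measurableP[N [mN N0 /measurable_EFinP mf]].
exists (fun x => if x \in N then c else f x), N; split => //.
- rewrite -(setUv N); apply/measurable_funU => //; first exact: measurableC.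
  split.
    apply: (eq_measurable_fun (cst c)); last exact: measurable_cst.
    by move=> x xN; rewrite /= xN.
  apply: (eq_measurable_fun f) => // x; rewrite in_setC => xN.
  by rewrite (negbTE xN).
- by move=> x nx; rewrite memNset.
- by move=> x xN; rewrite mem_set.
Qed.

Lemma borel_lebesgue_measurable (g : X -> \bar R) :
  measurable_fun setT g -> lebesgue_measurable_fun g.
Proof.
move=> mg; apply/completed_measurableP; exists set0; split => //.
exact: measurable_funTS.
Qed.

Lemma borel_weight (u : X -> R) :
  measurable_fun setT u -> (forall x, 0 < u x)%R -> weight u.
Proof.
by move=> mu_ u0; split => //; apply: borel_lebesgue_measurable; exact/measurable_EFinP.
Qed.

Lemma weight_borel (v : X -> R) : weight v ->
  exists (v' : X -> R) (N : set X), [/\ measurable_fun setT v', measurable N,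
    mu N = 0, (forall x, ~ N x -> v' x = v x) & (forall x, 0 < v' x)%R].
Proof.
move=> [/(@borel_representative _ 1%R)[v' [N [mv mN N0 vN vN1]]] v0].
exists v', N; split => // x; have [xN|xN] := pselect (N x).
  by rewrite vN1.
by rewrite vN.
Qed.

Lemma wnormE (q : R) (w : X -> R) (g : X -> \bar R) : (0 < q)%R ->
  (forall x, 0 < w x)%R ->
  wnorm q w g = (\int[mu]_x (`|g x| `^ q * (w x)%:E)) `^ q^-1.
Proof.
move=> q0 w0; rewrite /wnorm unlock; congr (_ `^ _); apply: eq_integral => x _.
have wq0 : (0 <= w x `^ q^-1)%R by rewrite powR_ge0.
rewrite abseM poweRM// (@gee0_abs _ (w x `^ q^-1)%:E) ?lee_fin//.
rewrite poweR_EFin -powRrM mulVf ?gt_eqF//.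
by rewrite powRr1// ltW.
Qed.

Lemma wnorm_EFinE (q : R) (w : X -> R) (f : X -> R) : (0 < q)%R ->
  (forall x, 0 < w x)%R ->
  wnorm q w (EFin \o f) = (\int[mu]_x (`|f x| `^ q * w x)%:E) `^ q^-1.
Proof.
move=> q0 w0; rewrite wnormE//; congr (_ `^ _); apply: eq_integral => x _.
Qed.

Lemma wnorm1_EFinE (w : X -> R) (f : X -> R) : (forall x, 0 < w x)%R ->
  wnorm 1 w (EFin \o f) = \int[mu]_x (`|f x| * w x)%:E.
Proof.
move=> w0; rewrite wnorm_EFinE// invr1 poweRe1.
  by apply: eq_integral => x _; rewrite powRr1.
by apply: integral_ge0 => x _; rewrite lee_fin mulr_ge0 ?powR_ge0// ltW.
Qed.

Let weighted_ge0 (q : R) (w : X -> R) (g : X -> \bar R) :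
  (forall x, 0 < w x)%R -> forall x, 0 <= `|g x| `^ q * (w x)%:E.
Proof. by move=> w0 x; rewrite mule_ge0 ?poweR_ge0// lee_fin ltW. Qed.

Lemma wnorm_eq_off_null (q : R) (w w' : X -> R) (g g' : X -> \bar R)
    (N N' : set X) : (0 < q)%R ->
  (forall x, 0 < w x)%R -> (forall x, 0 < w' x)%R ->
  measurable N -> mu N = 0 -> measurable N' -> mu N' = 0 ->
  (forall x, ~ N x -> w x = w' x) -> (forall x, ~ N' x -> g x = g' x) ->
  wnorm q w g = wnorm q w' g'.
Proof.
move=> q0 w0 w'0 mN N0 mN' N'0 ww gg; rewrite !wnormE//; congr (_ `^ _).
apply: (ge0_eq_integral_off_null (N := N `|` N')); try exact: weighted_ge0.
- exact: measurableU.
- by apply: measure_negligible; [exact: measurableU|];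
    apply: negligibleU; exact/negligibleP.
- by move=> x /not_orP[/ww -> /gg ->].
Qed.

Lemma integral_slab_off_null (f g : X -> R) (N A : set X) :
  measurable N -> mu N = 0 -> (forall x, ~ N x -> f x = g x) ->
  (forall x, 0 <= f x)%R -> (forall x, 0 <= g x)%R ->
  \int[mu]_(x in A) (f x)%:E = \int[mu]_(x in A) (g x)%:E.
Proof.
move=> mN N0 fg f0 g0; rewrite integral_mkcond [RHS]integral_mkcond.
apply: (ge0_eq_integral_off_null mN) => //.
- by move=> x; apply: erestrict_ge0 => y _; rewrite lee_fin.
- by move=> x; apply: erestrict_ge0 => y _; rewrite lee_fin.
- by move=> x /fg fgx; rewrite !patchE fgx.
Qed.

Lemma cyl_strong_typeP (p : R) (v : X -> R) : (1 < p)%R -> weight v ->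
  (forall N, \int[mu]_(x in slab N) (v x `^ (- (p - 1)^-1))%:E < +oo) <->
  exists2 u : X -> R, weight u & strong_type p M v u.
Proof.
move=> p1 wv; have [v' [Nv [mv' mNv Nv0 vv' v'0]]] := weight_borel wv.
have v0 := wv.2; have p0 : (0 < p)%R := lt_trans ltr01 p1.
have pV : (p^-1 * p = 1)%R by rewrite mulVf// gt_eqF.
have sE N : \int[mu]_(x in slab N) (v x `^ (- (p - 1)^-1))%:E =
    \int[mu]_(x in slab N) (v' x `^ (- (p - 1)^-1))%:E.
  apply: (integral_slab_off_null _ mNv Nv0) => x; rewrite ?powR_ge0//.
  by move=> /vv' ->.
split=> [vN|[u wu [S1 [C SC]]]].
  have [|w [mw w1] [C C0 CP]] := strong_type_sufficient p1 mv' v'0.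
    by move=> N; rewrite -sE.
  have w0 x : (0 < w x)%R by rewrite (lt_le_trans ltr01).
  (* For this weight (M f/w)^p = (M f)^p u. *)
  pose u x := (w x `^ (- p))%R.
  have u0 x : (0 < u x)%R by rewrite powR_gt0.
  have mu_ : measurable_fun setT u by apply: (measurableT_comp (measurable_powR _)).
  exists u; first exact: borel_weight.
  (* Passing to a Borel representative of f also yields the measurability of M f, which is part of
     belonging to L^p_u. *)
  have key (f : X -> R) : in_wLp p v (EFin \o f) ->
      lebesgue_measurable_fun (M f) /\
      wnorm p u (M f) <= (C `^ p^-1)%:E * wnorm p v (EFin \o f).
    move=> [/(@borel_representative _ 0%R)[f' [N [mf' mN N0 ff' _]]] _].
    have -> : M f = M f'.
      apply/funext => x; apply: (cyl_maximal_eq_off_null _ mN N0) => y /ff' ->//.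
    split; first by apply: borel_lebesgue_measurable; exact: measurable_cyl_maximal.
    rewrite (@wnorm_eq_off_null _ v v' _ (EFin \o f') Nv N)//; last 2 first.
    - by move=> x /vv'.
    - by move=> x /ff' /= ->.
    rewrite wnormE// wnorm_EFinE// -poweR_EFin -poweRM ?lee_fin//; last first.
      by apply: integral_ge0 => x _; rewrite lee_fin mulr_ge0 ?powR_ge0// ltW.
    apply: le_poweR; first by rewrite invr_ge0 ltW.
      by apply: integral_ge0 => x _; exact: weighted_ge0.
    apply: le_trans (CP f' mf'); apply: ge0_le_integral_nomeas => x _.
      exact: weighted_ge0.
    rewrite gee0_abs ?cyl_maximal_ge0// poweRM ?cyl_maximal_ge0//; last first.
      by rewrite lee_fin invr_ge0 ltW.
    by rewrite poweR_EFin /u -(powR_inv1 (ltW (w0 x))) -powRrM mulN1r.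
  split=> [f fLp|]; last by exists (C `^ p^-1)%R => f /key[].
  have [mMf Mf] := key f fLp; split => //; apply: le_lt_trans Mf _.
  by apply: lte_mul_pinfty; rewrite ?lee_fin ?powR_ge0//; exact: fLp.2.
have [u' [Nu [mu' mNu Nu0 uu' u'0]]] := weight_borel wu.
have u0 := wu.2.
have ms : measurable_fun setT (fun x => (v' x `^ (- (p - 1)^-1))%R).
  by apply: (measurableT_comp (measurable_powR _)).
suff H N : \int[mu]_(x in slab N) (v' x `^ (- (p - 1)^-1))%:E < +oo.
  by move=> N; rewrite sE.
apply: slab_integral_lty => // [x|A mA sA]; first by rewrite powR_ge0.
(* The norm inequality is raised to the power p; its constant may be negative, hence the absolute
   value. *)
apply: (@strong_type_necessary _ _ _ p v' u' (`|C| `^ p)%R) => // f mf fLp.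
have fLp' : in_wLp p v (EFin \o f).
  split; first by apply: borel_lebesgue_measurable; exact/measurable_EFinP.
  rewrite (@wnorm_eq_off_null _ v v' _ (EFin \o f) Nv set0)//; last first.
    by move=> x /vv'.
  by rewrite wnorm_EFinE// poweR_lty.
have := SC f fLp'.
rewrite (@wnorm_eq_off_null _ v v' _ (EFin \o f) Nv set0)//; last by move=> x /vv'.
rewrite (@wnorm_eq_off_null _ u u' _ (M f) Nu set0)//; last by move=> x /uu'.
rewrite wnormE// wnorm_EFinE//.
set a := \int[mu]_x _; set b := \int[mu]_x _ => ab.
have a0 : 0 <= a by apply: integral_ge0 => x _; exact: weighted_ge0.
have b0 : 0 <= b.
  by apply: integral_ge0 => x _; rewrite lee_fin mulr_ge0 ?powR_ge0// ltW.
have {}ab : a `^ p^-1 <= `|C|%:E * b `^ p^-1.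
  apply: le_trans ab _; apply: lee_wpmul2r; first exact: poweR_ge0.
  by rewrite lee_fin ler_norm.
have := le_poweR (ltW p0) (poweR_ge0 _ _) ab.
rewrite poweRM ?poweR_ge0 ?lee_fin// -!poweRrM pV !poweRe1// poweR_EFin.
by apply: le_trans; apply: ge0_le_integral_nomeas => x _;
  rewrite ?gee0_abs ?cyl_maximal_ge0// mule_ge0 ?poweR_ge0// lee_fin ltW.
Qed.

Lemma cyl_weak_typeP (v : X -> R) : weight v ->
  (forall N, exists V : R, {ae mu, forall x, slab N x -> ((v x)^-1 <= V)%R}) <->
  exists2 u : X -> R, weight u & weak_type11 M v u.
Proof.
move=> wv; have [v' [Nv [mv' mNv Nv0 vv' v'0]]] := weight_borel wv.
have v0 := wv.2.
have mv'V : measurable_fun setT (fun x => (v' x)^-1%R).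
  under eq_fun do rewrite -powR_inv1 ?ltW//.
  exact: (measurableT_comp (measurable_powR _)).
have mlt N V : measurable (slab N `&` [set x : X | V < (v' x)^-1]%R).
  apply: measurableI; first exact: measurable_slab.
  by rewrite -[X in measurable X]setTI; exact: measurable_fun_ltr.
have int0 (f : X -> R) : 0 <= \int[mu]_x (`|f x| * v' x)%:E.
  by apply: integral_ge0 => x _; rewrite lee_fin mulr_ge0// ltW.
have setE (f : X -> R) (l : R) :
    [set z | l%:E < `|M f z|] = [set z | l%:E < M f z].
  by apply/seteqP; split => z /=; rewrite gee0_abs// cyl_maximal_ge0.
split=> [vN|[u wu [C C0 CP]]].
  have [|u [mu_ u0] [C C0 CP]] := weak_type_sufficient mv' v'0.
    move=> N; have [V VN] := vN N; exists V; apply: measure_negligible => //.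
    have : mu.-negligible Nv by exact/negligibleP.
    move/(negligibleU VN); apply: negligibleS => x [xN /= h].
    have [xv|xv] := pselect (Nv x); [by right|left => /= /(_ xN)].
    by rewrite -vv'// leNgt h.
  exists u; first exact: borel_weight.
  exists C => // l f l0 [/(@borel_representative _ 0%R)[f' [N [mf' mN N0 ff' _]]] _].
  have -> : M f = M f'.
    apply/funext => x; apply: (cyl_maximal_eq_off_null _ mN N0) => y /ff' ->//.
  rewrite (@wnorm_eq_off_null _ v v' _ (EFin \o f') Nv N)//; last 2 first.
  - by move=> x /vv'.
  - by move=> x /ff' /= ->.
  rewrite wnorm1_EFinE// setE [(C / l)%R]mulrC EFinM -muleA lee_pdivlMl//.
  exact: CP.
have [u' [Nu [mu' mNu Nu0 uu' u'0]]] := weight_borel wu.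
have u0 := wu.2.
suff H N : exists V : R, mu (slab N `&` [set x | V < (v' x)^-1]%R) = 0.
  move=> N; have [V VN] := H N; exists V.
  have hV : mu.-negligible (slab N `&` [set x | V < (v' x)^-1]%R) by exact/negligibleP.
  have : mu.-negligible Nv by exact/negligibleP.
  move/(negligibleU hV); apply: negligibleS => x /= /not_implyP[xN /negP].
  rewrite -ltNge => h; have [xv|xv] := pselect (Nv x); [by right|left].
  by split => //=; rewrite vv'.
apply: slab_bounded => // A mA sA.
apply: (@weak_type_necessary _ _ _ v' u' C) => // f l l0 mf fLp.
have fLp' : in_wLp 1 v (EFin \o f).
  split; first by apply: borel_lebesgue_measurable; exact/measurable_EFinP.
  rewrite (@wnorm_eq_off_null _ v v' _ (EFin \o f) Nv set0)//; last first.
    by move=> x /vv'.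
  by rewrite wnorm1_EFinE.
have := CP l f l0 fLp'.
rewrite (@wnorm_eq_off_null _ v v' _ (EFin \o f) Nv set0)//; last by move=> x /vv'.
rewrite wnorm1_EFinE// setE (@integral_slab_off_null u u' Nu)//; last 3 first.
- by move=> x /uu'.
- by move=> x; rewrite ltW.
- by move=> x; rewrite ltW.
by rewrite mulrC EFinM -muleA lee_pdivlMl.
Qed.

End weighted_norms.

(** * Compact sets of the cylinder *)

(** The sigma-algebra is generated by the coordinates; an open set belongs to it as the countable
    union of the rational cubes that it contains. *)
Lemma open_rV_measurable (R : realType) (d : nat) (U : set 'rV[R]_d) :
  open U -> measurable U.
Proof.
move=> oU; pose I := ('rV[rat]_d * rat)%type.
pose c (i : I) : 'rV[R]_d := map_mx ratr i.1.
pose B (i : I) : set 'rV[R]_d := cube (c i) (ratr i.2).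
rewrite (_ : U = \bigcup_(i in [set i | B i `<=` U]) B i).
  rewrite bigcup_mkcond; apply: countable_bigcupT_measurable; first exact: countableP.
  by move=> i; case: ifP => // _; exact: measurable_cube.
apply/seteqP; split => [z Uz|z [i /= + iz]]; last exact.
have /nbhs_ballP[e /= e0 zeU] : nbhs z U by exact: open_nbhs_nbhs.
have /rat_in_itvoo[q] : 0 < e / 2 by rewrite divr_gt0.
rewrite inE/= => /itvP qe.
have q0 : 0 < ratr q :> R by rewrite qe.
have H (i : 'I_d) : exists x : rat, `|z ord0 i - ratr x| < ratr q.
  have /rat_in_itvoo[x] : z ord0 i - ratr q < z ord0 i + ratr q by lra.
  by rewrite inE/= => /itvP xP; exists x; rewrite distrC ltr_distl !xP.
have [x xP] := choice H.
exists (\row_i x i, q).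
  move=> w wB; apply: zeU; split => // i j; rewrite (ord1 i) /ball/=.
  have := wB j; have := xP j; rewrite /c !mxE /=.
  have : ratr q < e / 2 by rewrite qe.
  rewrite !ltr_norml => ? /andP[? ?] /andP[? ?]; apply/andP; split; lra.
by move=> j; rewrite /c !mxE /=; exact: xP.
Qed.

Section cylinder_topology.
Context {R : realType} {n d : nat}.
Local Notation X := (cyl R n d).
Local Notation pi := (\pi_X : 'rV[R]_d -> X)%qT.

(** The distance from t to the integers, since floor(t + 1/2) is a nearest one; unlike t - floor(t +
    1/2) itself, it is continuous. *)
Definition dist_int (t : R) : R := `|t - (Num.floor (t + 2^-1))%:~R|.

Lemma dist_int_le (t : R) (j : int) : dist_int t <= `|t - j%:~R|.
Proof.
have /andP[h1 h2] := floor_itv (t + 2^-1).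
rewrite intrD1 in h2; set k := Num.floor _ in h1 h2 *.
rewrite /dist_int -/k; have [->//|kj] := eqVneq k j.
have t12 : `|t - k%:~R| <= 2^-1 by rewrite ler_norml; apply/andP; split; lra.
apply: (le_trans t12); have : 1 <= `|k%:~R - j%:~R : R|.
  rewrite -intrB -intr_norm ler1z -gtz0_ge1 normr_gt0 subr_eq0//.
move: t12; rewrite ler_norml => /andP[? ?].
rewrite !ler_normr => /orP[?|?]; apply/orP; [left|right]; lra.
Qed.

Lemma dist_int_lip (s t : R) : dist_int s <= dist_int t + `|s - t|.
Proof.
apply: le_trans (dist_int_le s (Num.floor (t + 2^-1))) _.
rewrite /dist_int; set k := Num.floor _.
have -> : s - k%:~R = (t - k%:~R) + (s - t) by ring.
exact: ler_normD.
Qed.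

Lemma dist_int_continuous : continuous dist_int.
Proof.
move=> t; apply/cvgrPdist_lt => e e0; near=> s.
have st : `|t - s| < e by near: s; exact: cvgr_dist_lt.
apply: le_lt_trans st; rewrite ler_norml; apply/andP; split.
  by have := dist_int_lip s t; rewrite distrC; lra.
by have := dist_int_lip t s; lra.
Unshelve. all: by end_near. Qed.

Lemma dist_int_period (t : R) (j : int) : dist_int (t + j%:~R) = dist_int t.
Proof.
apply/eqP; rewrite eq_le; apply/andP; split.
  have := dist_int_le (t + j%:~R) (Num.floor (t + 2^-1) + j).
  rewrite intrD /dist_int.
  by rewrite (_ : t + _ - (_ + _) = t - (Num.floor (t + 2^-1))%:~R)//; ring.
have := dist_int_le t (Num.floor (t + j%:~R + 2^-1) - j).
rewrite intrB /dist_int.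
rewrite (_ : t - (_ - _) = t + j%:~R - (Num.floor (t + j%:~R + 2^-1))%:~R)//.
by ring.
Qed.

(* Unlike the coordinates of repr, these functions are continuous on the quotient;
   they separate points. *)
Definition coord_dist (i : 'I_d) (x : X) (z : 'rV[R]_d) : R :=
  if (i < n)%N then dist_int (z ord0 i - repr x ord0 i)
  else z ord0 i - repr x ord0 i.

Lemma coord_dist_reduce i x z : coord_dist i x (reduce n z) = coord_dist i x z.
Proof.
rewrite /coord_dist; case: ifP => ilt; rewrite mxE ilt//.
by rewrite addrAC -intrN dist_int_period.
Qed.

Lemma coord_dist_continuous i x :
  continuous (coord_dist i x \o (repr : X -> 'rV[R]_d)).
Proof.
apply/quotient_continuous.
rewrite (_ : _ \o _ = coord_dist i x); last first.
  by apply/funext => z /=; rewrite repr_pi_cyl coord_dist_reduce.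
have c1 : continuous (fun z : 'rV[R]_d => z ord0 i - repr x ord0 i).
  move=> z; apply: (@continuousB _ _ _ (fun z : 'rV[R]_d => z ord0 i)
    (cst (repr x ord0 i))); last exact: cst_continuous.
  exact: (@coord_continuous R 1 d ord0 i z).
rewrite /coord_dist; case: (i < n)%N => //.
by move=> z; exact: (continuous_comp (c1 z) (@dist_int_continuous _)).
Qed.

(** Continuous real functions agree at points that cannot be separated. As [coord_dist i x] vanishes
    at x it vanishes at y, so the representatives agree in the free coordinates and differ by
    integers in the periodic ones; these integers are 0 because both points lie in [-1/2, 1/2).
    Compact sets are then closed, hence Borel. *)
Lemma cyl_hausdorff : hausdorff_space X.
Proof.
move=> x y xy.
have sep (g : X -> R) : continuous g -> g x = g y.
  move=> cg; apply: (@norm_hausdorff _ R) => A B /cg gA /cg gB.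
  have [w [wA wB]] := xy _ _ gA gB; by exists (g w).
have E i : coord_dist i x (repr y) = 0.
  rewrite -[LHS]/((coord_dist i x \o repr) y) -(sep _ (@coord_dist_continuous i x)).
  rewrite /= /coord_dist subrr /dist_int; case: ifP => // _.
  have -> : Num.floor (0 + 2^-1 : R) = 0.
    by apply/floor_def; rewrite !add0r; apply/andP; split; lra.
  by rewrite subr0 normr0.
rewrite -[x]reprK -[y]reprK; congr (pi _); apply/rowP => i.
apply/eqP; rewrite eq_sym -subr_eq0; have := E i; rewrite /coord_dist.
case: ifP => ilt; last by move=> ->.
move=> /eqP; rewrite normr_eq0 subr_eq0 => /eqP.
have /andP[? ?] := fundamental_repr x ilt; have /andP[? ?] := fundamental_repr y ilt.
set k := Num.floor _ => h.
have k1 : -1 < k by rewrite -(ltr_int R) mulrN1z; lra.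
have k2 : k < 0 + 1 by rewrite add0r -(ltr_int R); lra.
have k0 : k = 0 by apply/eqP; rewrite eq_le -ltzD1 k2 -lezD1 addNr in k1 *.
by move: h; rewrite k0 subr0 => /eqP; rewrite subr_eq0.
Qed.

Lemma cyl_open_measurable (U : set X) : open U -> measurable U.
Proof. by move=> oU; apply/measurable_cylP; exact: open_rV_measurable. Qed.

(** Membership in [inLp_loc] includes the measurability of the restriction to each compact set. *)
Lemma cyl_compact_measurable (K : set X) : compact K -> measurable K.
Proof.
move=> cK; rewrite -(setCK K); apply: measurableC; apply: cyl_open_measurable.
by apply: closed_openC; exact: compact_closed cyl_hausdorff cK.
Qed.

Lemma open_slab N : open (slab N : set X).
Proof.
have : open (pi @^-1` slab N : set 'rV[R]_d); last by [].
rewrite openE => z zN.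
have H (i : 'I_d) : \forall w \near z, (n <= i)%N -> `|(w : 'rV[R]_d) ord0 i| < N%:R.
  case: (leqP n i) => [ni|_]; last by near=> w.
  have zi : `|z ord0 i| < N%:R by have := zN i ni; rewrite repr_pi_cyl mxE ltnNge ni.
  have ci := @coord_continuous R 1 d ord0 i z.
  near=> w => _; near: w; exact: (cvgr_norm_lt _ ci).
change (\forall w \near z, (pi @^-1` slab N) w).
pose P (i : 'I_d) := [set w : 'rV[R]_d | (n <= i)%N -> `|w ord0 i| < N%:R].
have HH := @filter_forall _ _ P (nbhs (z : 'rV[R]_d)) (nbhs_filter z) H.
apply: (@filterS _ _ (nbhs_filter z) _ _ _ HH) => w wN i ni.
by rewrite repr_pi_cyl mxE ltnNge ni; exact: wN.
Unshelve. all: by end_near. Qed.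

(** Slabs are open and nested, so a finite subcover lies in a single slab. *)
Lemma compact_sub_slab (K : set X) : compact K -> exists N, K `<=` slab N.
Proof.
rewrite compact_cover => /(_ nat setT (fun N => slab N)) [||D _ KD].
- by move=> N _; exact: open_slab.
- by move=> x _; have : [set: X] x by []; rewrite -bigcup_slab.
exists (\max_(i <- finmap.enum_fset D) i)%N => x /KD[N /= ND].
suff : (slab N : set X) `<=` slab (\max_(i <- finmap.enum_fset D) i)%N by apply.
by apply/subsetPset/nondecreasing_slab; exact: leq_bigmax_seq.
Qed.

Lemma slab_sub_compact N : exists2 K : set X, compact K & slab N `<=` K.
Proof.
exists (pi @` [set z : 'rV[R]_d | forall i, `[- N.+1%:R, N.+1%:R]%classic (z ord0 i)]).
  apply: continuous_compact.
    by apply: continuous_subspaceT; exact: pi_continuous.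
  apply: (@rV_compact R d (fun=> `[- N.+1%:R, N.+1%:R]%classic)) => i.
  exact: segment_compact.
move=> x xN; exists (repr x); last by rewrite reprK.
move=> i /=; rewrite in_itv/= -ler_norml; apply: ltW; exact: slab_subset_box.
Qed.

Lemma slab_torus N : (d <= n)%N -> slab N = [set: X].
Proof.
move=> dn; apply/seteqP; split => // x _ i ni.
by have := leq_trans (leq_trans (ltn_ord i) dn) ni; rewrite ltnn.
Qed.

End cylinder_topology.

(** * Norms over compact sets and the resulting equivalences *)

Section local_norms.
Context {R : realType} {n d : nat}.
Local Notation X := (cyl R n d).
Local Notation mu := (@cyl_measure R n d).
Local Open Scope ereal_scope.

Lemma lebesgue_measurable_powR (v : X -> R) (r : R) :
  lebesgue_measurable_fun (EFin \o v) ->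
  lebesgue_measurable_fun (fun x => (v x `^ r)%:E).
Proof.
move=> /completed_measurableP[N [mN N0 /measurable_EFinP mv]].
apply/completed_measurableP; exists N; split => //; apply/measurable_EFinP.
exact: (measurableT_comp (measurable_powR _)).
Qed.

Lemma lebesgue_measurable_inv (v : X -> R) : weight v ->
  lebesgue_measurable_fun (fun x => (v x)^-1%:E).
Proof.
move=> wv; rewrite (_ : (fun x => _) = fun x => (v x `^ (- 1))%:E); last first.
  by apply/funext => x; rewrite powR_inv1// ltW// wv.2.
by apply: lebesgue_measurable_powR; exact: wv.1.
Qed.

Lemma lebesgue_measurable_patch (f : X -> \bar R) (A : set X) : measurable A ->
  lebesgue_measurable_fun f -> lebesgue_measurable_fun (f \_ A).
Proof.
move=> mA /completed_measurableP[N [mN N0 mf]].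
apply/completed_measurableP; exists N; split => //.
apply/(measurable_restrict _ mA (measurableC mN)).
by apply: measurable_funS mf; [exact: measurableC|exact: subIsetl].
Qed.

(** Since p' = p/(p - 1), the power p' of v^(-1/p) is v^(-1/(p-1)), and the norm is finite exactly
    when the integral under the root is. *)
Lemma Lnorm_patch_lty (p p' : R) (v : X -> R) (A : set X) : (1 < p)%R ->
  (p^-1 + p'^-1 = 1)%R ->
  'N[mu]_p'%:E[(fun x => (v x `^ (- p^-1))%:E) \_ A] < +oo <->
  \int[mu]_(x in A) (v x `^ (- (p - 1)^-1))%:E < +oo.
Proof.
move=> p1 pp'; have p0 : (p != 0)%R by rewrite gt_eqF// (lt_trans ltr01).
have p10 : (p - 1 != 0)%R by rewrite subr_eq0 gt_eqF.
have p'E : (p' = p / (p - 1))%R.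
  rewrite -[LHS]invrK (_ : p'^-1 = 1 - p^-1)%R; last by rewrite -pp' addrC addKr.
  by rewrite (_ : 1 - p^-1 = (p - 1) / p)%R ?invf_div//; field.
have p'0 : (p' != 0)%R by rewrite p'E mulf_neq0// invr_eq0.
have E : \int[mu]_x `|((fun x => (v x `^ (- p^-1))%:E) \_ A) x| `^ p' =
    \int[mu]_(x in A) (v x `^ (- (p - 1)^-1))%:E.
  rewrite [RHS]integral_mkcond; apply: eq_integral => x _ /=.
  rewrite !patchE; case: ifPn => _; last by rewrite abse0 poweR0r.
  rewrite abse_EFin ger0_norm ?powR_ge0// poweR_EFin -powRrM.
  by rewrite mulNr p'E mulrA mulVf// mul1r.
rewrite unlock E; split; last exact: poweR_lty.
by apply: lty_poweRy; rewrite invr_eq0.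
Qed.

Lemma Lnormy_patch_lty (w : X -> R) (A : set X) : (forall x, 0 <= w x)%R ->
  'N[mu]_+oo[(fun x => (w x)%:E) \_ A] < +oo <->
  exists V : R, {ae mu, forall x, A x -> (w x <= V)%R}.
Proof.
move=> w0; rewrite unlock.
have E (V : R) : (0 <= V)%R ->
    {ae mu, forall x, (abse \o (EFin \o w) \_ A) x <= V%:E} <->
    {ae mu, forall x, A x -> (w x <= V)%R}.
  move=> V0; split; apply: filterS => x; rewrite /= patchE.
    by move=> + xA; rewrite mem_set// abse_EFin ger0_norm.
  case: ifPn => [/set_mem xA /(_ xA)|_ _]; last by rewrite abse0 lee_fin.
  by rewrite abse_EFin ger0_norm.
(* The norm for the exponent +oo is 0 by convention when the whole space has measure 0; then every
   set is negligible. *)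
case: ifPn => [_|]; last first.
  rewrite -leNgt => muT; split => // _; exists 0%R.
  exists setT; split => //; apply/eqP; rewrite eq_le muT; exact: measure_ge0.
split => [h|[V]].
  set s := ess_sup_inf.ess_sup _ _ in h.
  have [V V0 sV] : exists2 V : R, (0 <= V)%R & s <= V%:E.
    case: s h => [r _|//|_]; last by exists 0%R => //; rewrite leNye.
    by exists (Num.max r 0)%R; rewrite ?lee_fin le_max lexx ?orbT.
  by exists V; apply/E => //; apply/ess_sup_inf.ess_supP.
(* The bound must be nonnegative because the patched function is 0 outside A. *)
move=> AV; apply: (@le_lt_trans _ _ (Num.max V 0)%:E); last exact: ltry.
apply/ess_sup_inf.ess_supP/E; first by rewrite le_max lexx orbT.
by apply: filterS AV => x + xA => /(_ xA) wV; rewrite le_max wV.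
Qed.

Lemma integral_patch_lty_locP (g : X -> R) : (forall x, 0 <= g x)%R ->
  (forall K : set X, compact K -> \int[mu]_(x in K) (g x)%:E < +oo) <->
  (forall N, \int[mu]_(x in slab N) (g x)%:E < +oo).
Proof.
move=> g0.
have le A B : A `<=` B -> \int[mu]_(x in A) (g x)%:E <= \int[mu]_(x in B) (g x)%:E.
  move=> AB; rewrite [leLHS]integral_mkcond [leRHS]integral_mkcond.
  apply: ge0_le_integral_nomeas => x _.
    by apply: erestrict_ge0 => y _; rewrite lee_fin.
  rewrite !patchE; case: ifPn => [/set_mem/AB xB|_]; first by rewrite mem_set.
  by case: ifP => // _; rewrite lee_fin.
split => [h N|h K].
  have [K cK NK] := @slab_sub_compact R n d N.
  exact: le_lt_trans (le _ _ NK) (h K cK).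
by move=> /compact_sub_slab[N KN]; exact: le_lt_trans (le _ _ KN) (h N).
Qed.

Lemma ae_bounded_locP (g : X -> R) :
  (forall K : set X, compact K ->
    exists V : R, {ae mu, forall x, K x -> (g x <= V)%R}) <->
  (forall N, exists V : R, {ae mu, forall x, slab N x -> (g x <= V)%R}).
Proof.
split => [h N|h K].
  have [K cK NK] := @slab_sub_compact R n d N.
  by have [V hV] := h K cK; exists V; apply: filterS hV => x + /NK.
move=> /compact_sub_slab[N KN].
by have [V hV] := h N; exists V; apply: filterS hV => x + /KN.
Qed.

Lemma inLp_loc_strongP (p p' : R) (v : X -> R) : (1 < p)%R ->
  (p^-1 + p'^-1 = 1)%R -> weight v ->
  inLp_loc p'%:E (fun x => (v x `^ (- p^-1))%:E) <->
  exists2 u : X -> R, weight u & strong_type p (@cyl_maximal R n d) v u.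
Proof.
move=> p1 pp' wv; rewrite -(cyl_strong_typeP p1 wv).
rewrite -integral_patch_lty_locP; last first.
  by move=> x; exact: powR_ge0.
split => h K cK; first by apply/(Lnorm_patch_lty _ _ p1 pp'); exact: (h K cK).2.
split; last by apply/(Lnorm_patch_lty _ _ p1 pp'); exact: h.
apply: lebesgue_measurable_patch; first exact: cyl_compact_measurable.
by apply: lebesgue_measurable_powR; exact: wv.1.
Qed.

Lemma inLp_loc_weakP (v : X -> R) : weight v ->
  inLp_loc +oo (fun x => (v x)^-1%:E) <->
  exists2 u : X -> R, weight u & weak_type11 (@cyl_maximal R n d) v u.
Proof.
move=> wv; rewrite -(cyl_weak_typeP wv) -ae_bounded_locP.
have v0 x : (0 <= (v x)^-1)%R by rewrite invr_ge0 ltW// wv.2.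
split => h K cK; first by apply/(Lnormy_patch_lty _ v0); exact: (h K cK).2.
split; last by apply/(Lnormy_patch_lty _ v0); exact: h.
apply: lebesgue_measurable_patch; first exact: cyl_compact_measurable.
exact: lebesgue_measurable_inv.
Qed.

Lemma inLp_torus_strongP (p p' : R) (v : X -> R) : (d <= n)%N -> (1 < p)%R ->
  (p^-1 + p'^-1 = 1)%R -> weight v ->
  inLp p'%:E (fun x => (v x `^ (- p^-1))%:E) <->
  exists2 u : X -> R, weight u & strong_type p (@cyl_maximal R n d) v u.
Proof.
move=> dn p1 pp' wv; rewrite -(cyl_strong_typeP p1 wv).
split => [[_ h] N|h].
  by rewrite slab_torus//; apply/(Lnorm_patch_lty _ _ p1 pp'); rewrite patch_setT.
split; first by apply: lebesgue_measurable_powR; exact: wv.1.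
rewrite -[X in 'N[_]_(_)[X]](patch_setT (cst point)).
apply/(Lnorm_patch_lty _ _ p1 pp').
by rewrite -(slab_torus 0 dn); exact: h.
Qed.

Lemma inLp_torus_weakP (v : X -> R) : (d <= n)%N -> weight v ->
  inLp +oo (fun x => (v x)^-1%:E) <->
  exists2 u : X -> R, weight u & weak_type11 (@cyl_maximal R n d) v u.
Proof.
move=> dn wv; rewrite -(cyl_weak_typeP wv).
have v0 x : (0 <= (v x)^-1)%R by rewrite invr_ge0 ltW// wv.2.
split => [[_ h] N|h].
  by rewrite slab_torus//; apply/(Lnormy_patch_lty _ v0); rewrite patch_setT.
split; first exact: lebesgue_measurable_inv.
rewrite -[X in 'N[_]_(_)[X]](patch_setT (cst point)); apply/(Lnormy_patch_lty _ v0).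
by rewrite -(slab_torus 0 dn); exact: h.
Qed.

End local_norms.

Theorem proposition3p4 (R : realType) (n m : nat) (p p' : R) (p_gt1 : 1 < p)
    (pp' : p^-1 + p'^-1 = 1) :
  (forall v : torus R n -> R, weight v ->
    (inLp p'%:E (fun x => (v x `^ (- p^-1))%:E) <->
     exists2 u : torus R n -> R, weight u &
       strong_type p (torus_maximal R n) v u) /\
    (inLp +oo%E (fun x => (v x)^-1%:E) <->
     exists2 u : torus R n -> R, weight u &
       weak_type11 (torus_maximal R n) v u)) /\
  (forall v : waveguide R n m -> R, weight v ->
    (inLp_loc p'%:E (fun x => (v x `^ (- p^-1))%:E) <->
     exists2 u : waveguide R n m -> R, weight u &
       strong_type p (waveguide_maximal R n m) v u) /\
    (inLp_loc +oo%E (fun x => (v x)^-1%:E) <->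
     exists2 u : waveguide R n m -> R, weight u &
       weak_type11 (waveguide_maximal R n m) v u)).
Proof.
split => v wv; split.
- exact: inLp_torus_strongP.
- exact: inLp_torus_weakP.
- exact: inLp_loc_strongP.
- exact: inLp_loc_weakP.
Qed.
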